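(* Let $k$ be an algebraically closed field of characteristic $p>2$, let $\mathbb{H}=k((y^{\mathbb{Q}}))$ be the Hahn field with its valuation $v$, and let $K$ be a field with $k(y)\subseteq K\subseteq\mathbb{H}$ such that $(K,v)$ is Henselian, $K$ is perfect, and $K$ has no finite limits. Let $$\alpha=\sum_{n=1}^\infty y^{-1/p^n},\qquad \eta=\sum_{n=1}^\infty\alpha^{2/p^n}\in\mathbb{H},$$ so that $\alpha^p-\alpha=y^{-1}$ and $\eta^p-\eta=\alpha^2$, and let $L=K(\alpha)$, $M=L(\eta)$. Then $\mathrm{depth}(M/K,v)=2$.
   Context: $\mathbb{H}$ is the field of formal series $s=\sum_{q\in\mathbb{Q}}\lambda_qy^q$, $\lambda_q\in k$, with well-ordered support $\mathrm{supp}(s)=\{q\mid\lambda_q\neq0\}$, and $v(s)=\min\mathrm{supp}(s)$. $K$ has no finite limits if for every $a\in K$ the set $\mathrm{supp}(a)$ has no accumulation point in $\mathbb{R}$ (so $\mathrm{supp}(a)$ is finite or its only limit is $\infty$). $\overline{K}$ denotes the algebraic closure of $K$ in $\mathbb{H}$ and $\Gamma=v\overline{K}$. Depth. For $\theta\in\overline{K}$ of degree $n$ over $K$ and $1\le m\le n$, let $D_m(\theta)=\{v(\theta-b)\mid b\in\overline{K},\ \deg_K b=m\}\subseteq\Gamma\cup\{\infty\}$. Define integers $1=d_0<d_1<\cdots<d_r=n$ by $d_0=1$ and, as long as $d_{\ell-1}<n$, $d_\ell$ is the least integer $m>d_{\ell-1}$ such that some $\epsilon\in D_m(\theta)$ satisfies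 $\epsilon>x$ for all $x\in D_{d_{\ell-1}}(\theta)$. Then $\mathrm{depth}(\theta):=r$. (Originally, depth is defined as the common length of the Mac Lane–Vaquié chains of the valuation $f\mapsto v(f(\theta))$ on $K[x]$; by a known theorem it equals this $r$, which may be taken as the definition.) For a finite simple extension $M/K$ inside $\overline{K}$, $\mathrm{depth}(M/K,v):=\min\{\mathrm{depth}(\theta)\mid M=K(\theta)\}$. *)

(* Defs.v *)
From HB Require Import structures.
From mathcomp Require Import all_boot all_order all_algebra.
From mathcomp Require Import boolp classical_sets functions cardinality fsbigop.
From mathcomp Require Import reals constructive_ereal topology num_topology.

Set Implicit Arguments.
Unset Strict Implicit.
Unset Printing Implicit Defensive.

Import Order.TTheory GRing.Theory Num.Theory.
Import numFieldTopology.Exports.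

Local Open Scope classical_set_scope.
Local Open Scope ring_scope.

Definition least {d} {T : porderType d} (A : set T) (m : T) : Prop :=
  A m /\ lbound A m.

Definition well_ordered (A : set rat) : Prop :=
  forall B : set rat, B `<=` A -> B !=set0 -> exists m, least B m.

Lemma wo_sub (A B : set rat) : A `<=` B -> well_ordered B -> well_ordered A.
Proof. by move=> AB wB C CA; apply: wB; apply: subset_trans AB. Qed.

Lemma wo_set0 : well_ordered set0.
Proof. by move=> B B0 [x /B0]. Qed.

Lemma wo_set1 (q : rat) : well_ordered [set q].
Proof.
move=> B B1 [x Bx]; exists x; split=> // y By.
by rewrite (B1 _ Bx) (B1 _ By).
Qed.

Lemma wo_setU (A B : set rat) :
  well_ordered A -> well_ordered B -> well_ordered (A `|` B).
Proof.
move=> wA wB C CAB [c Cc].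
have [|nA] := pselect ((C `&` A) !=set0); last first.
  apply: (wB C); last by exists c.
  move=> x Cx; case: (CAB x Cx) => // Ax; exfalso; apply: nA.
  by exists x.
move=> /(wA _ (@subIsetr _ C A)) [a [[Ca Aa] la]].
have [|nB] := pselect ((C `&` B) !=set0); last first.
  exists a; split=> // x Cx; case: (CAB x Cx) => [Ax|Bx]; first by apply: la.
  by exfalso; apply: nB; exists x.
move=> /(wB _ (@subIsetr _ C B)) [b [[Cb Bb] lb]].
exists (Num.min a b); split; first by case: leP.
move=> x Cx; rewrite ge_min; apply/orP.
by case: (CAB x Cx) => [Ax|Bx]; [left; apply: la | right; apply: lb].
Qed.

Lemma wo_sumset (A B : set rat) : well_ordered A -> well_ordered B ->
  well_ordered [set q | exists2 a, A a & B (q - a)].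
Proof.
move=> wA wB C CS [c Cc].
pose E a b := [/\ A a, B b & C (a + b)].
have CE x : C x -> exists a b, E a b /\ x = a + b.
  move=> Cx; have [a Aa Bb] := CS _ Cx.
  by exists a, (x - a); rewrite /E [a + _]addrC subrK.
pose F : set rat := [set b | exists2 a, E a b &
  forall a' b', E a' b' -> a' + b' < a + b -> a <= a'].
have FB : F `<=` B by move=> b [a []].
have F0 : F !=set0.
  have [a0 [b0 [E0 _]]] := CE _ Cc.
  have [a [[b Eab] la]] : exists a, least [set a | exists b, E a b] a.
    apply: wA; first by move=> a [b []].
    by exists a0, b0.
  by exists b, a => // a' b' Ea' _; apply: la; exists b'.
have [b [[a Eab Fab] lb]] := wB _ FB F0.
have [A_ B_ C_] := Eab.
exists (a + b); split=> // x Cx; rewrite leNgt; apply/negP => xab.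
have [a0 [b0 [E0 x0]]] := CE _ Cx.
have [a1 [[b1 [Eab1 lt1]] la1]] : exists a1,
    least [set a1 | exists b1, E a1 b1 /\ a1 + b1 < a + b] a1.
  apply: wA; first by move=> ? [? [[]]].
  by exists a0, b0; rewrite -x0.
have aa1 : a <= a1 by apply: Fab lt1.
have : b <= b1.
  apply: lb; exists a1 => // a' b' E' lt'.
  by apply: la1; exists b'; split=> //; apply: lt_trans lt1.
rewrite leNgt => /negP; apply.
by rewrite -(ltrD2l a); apply: le_lt_trans lt1; rewrite lerD2r.
Qed.

Lemma wo_conv_finite (A B : set rat) (q : rat) : well_ordered A ->
  well_ordered B -> finite_set [set a | A a /\ B (q - a)].
Proof.
move=> wA wB; set S := [set a | _].
have maxS C : C `<=` S -> C !=set0 -> exists m, C m /\ ubound C m.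
  move=> CS [c Cc].
  have [m [[x Cx xm] lm]] : exists m, least [set q - x | x in C] m.
    apply: wB; last by exists (q - c), c.
    by move=> _ [x /CS [_ Bx] <-].
  exists x; split=> // y Cy; have := lm (q - y).
  by rewrite -xm lerD2l lerN2; apply; exists y.
pose T : set rat := [set x | S x /\ ~ finite_set (S `&` [set y | y <= x])].
have [T0|nT] := pselect (T !=set0).
  have [x [[Sx nx] lx]] : exists x, least T x.
    by apply: wA T0 => x [[]].
  exfalso; apply: nx.
  have sub (D : set rat) : finite_set D ->
      S `&` [set y | y < x] `<=` D -> finite_set (S `&` [set y | y <= x]).
    move=> fD sD; apply: (@sub_finite_set _ _ (D `|` [set x])).
      move=> y [Sy /=]; rewrite le_eqVlt => /orP[/eqP ->|yx]; first by right.
      by left; apply: sD.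
    by rewrite finite_setU; split=> //; apply: finite_set1.
  have [e|/set0P ne] := eqVneq (S `&` [set y | y < x]) set0.
    by apply: (sub set0); rewrite ?e.
  have [z [[Sz /= zx] uz]] := maxS _ (@subIsetl _ S _) ne.
  apply: (sub (S `&` [set y | y <= z])).
    apply: contrapT => nz; have : x <= z by apply: lx.
    by rewrite leNgt zx.
  by move=> y [Sy /= yx]; split=> //; apply: uz.
have [->|/set0P S0] := eqVneq S set0; first by apply: finite_set0.
have [m [Sm um]] := maxS S (fun _ => id) S0.
apply: (@sub_finite_set _ _ (S `&` [set y | y <= m])).
  by move=> x Sx; split=> //; apply: um.
by apply: contrapT => nm; apply: nT; exists m.
Qed.

Lemma wo_conv_seq (A B : set rat) (q : rat) : well_ordered A ->
  well_ordered B ->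
  exists2 r : seq rat, uniq r & forall a, (a \in r) <-> (A a /\ B (q - a)).
Proof.
move=> wA wB; have /finite_seqP[r Er] := @wo_conv_finite A B q wA wB.
exists (undup r); first exact: undup_uniq.
by move=> a; rewrite mem_undup -[X in _ <-> X]/([set a | _] a) Er.
Qed.

Record hahn (k : fieldType) := Hahn {
  hcoef :> rat -> k;
  hcoef_wo : well_ordered [set q | hcoef q != 0]
}.

Definition hsupp {k : fieldType} (s : hahn k) : set rat := [set q | s q != 0].

HB.instance Definition _ (k : fieldType) := gen_eqMixin (hahn k).
HB.instance Definition _ (k : fieldType) := gen_choiceMixin (hahn k).

Section HahnRing.
Variable k : fieldType.
Implicit Types s t u : hahn k.

Lemma hahnP s t : s =1 t -> s = t.
Proof.
case: s t => [f fP] [g gP] /= /funext fg.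
by subst g; congr Hahn; apply: Prop_irrelevance.
Qed.

Lemma hsupp_wo s : well_ordered (hsupp s).
Proof. exact: hcoef_wo. Qed.
Arguments hsupp_wo : clear implicits.

Fact hzero_wo : well_ordered [set q | (fun _ : rat => 0 : k) q != 0].
Proof. by apply: (wo_sub _ wo_set0) => q /=; rewrite eqxx. Qed.

Fact hadd_wo s t : well_ordered [set q | (fun q => s q + t q) q != 0].
Proof.
apply: (wo_sub _ (wo_setU (hsupp_wo s) (hsupp_wo t))) => q /= nz.
have [s0|] := eqVneq (s q) 0; last by left.
by right; move: nz; rewrite s0 add0r.
Qed.

Fact hopp_wo s : well_ordered [set q | (fun q => - s q) q != 0].
Proof. by apply: (wo_sub _ (hsupp_wo s)) => q /=; rewrite oppr_eq0. Qed.

Fact hmonom_wo (q : rat) (c : k) :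
  well_ordered [set a | (fun a => if a == q then c else 0) a != 0].
Proof.
by apply: (wo_sub _ (wo_set1 (q := q))) => a /=; case: (a =P q) => //; rewrite eqxx.
Qed.

Definition hmul_coef (f g : rat -> k) (q : rat) : k :=
  \sum_(a \in [set: rat]) f a * g (q - a).

Lemma hmul_coefE (f g : rat -> k) q (r : seq rat) : uniq r ->
  (forall a, f a != 0 -> g (q - a) != 0 -> a \in r) ->
  hmul_coef f g q = \sum_(a <- r) f a * g (q - a).
Proof.
move=> ur hr; rewrite /hmul_coef (fsbigE r) //.
  by apply: eq_bigl => a; rewrite in_setT.
move=> a _; apply: contraNeq; rewrite mulf_eq0 negb_or => /andP[].
exact: hr.
Qed.

Lemma hmul_coef_neq0 (f g : rat -> k) q :
  hmul_coef f g q != 0 -> exists2 a, f a != 0 & g (q - a) != 0.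
Proof.
apply: contra_neqP => H; apply: fsbig1 => a _; apply: contra_notP H.
by move=> /eqP; rewrite mulf_eq0 negb_or => /andP[]; exists a.
Qed.

Fact hmul_wo s t : well_ordered [set q | hmul_coef s t q != 0].
Proof.
apply: (wo_sub _ (wo_sumset (hsupp_wo s) (hsupp_wo t))) => q.
exact: hmul_coef_neq0.
Qed.

Definition hzero : hahn k := Hahn hzero_wo.
Definition hadd s t : hahn k := Hahn (@hadd_wo s t).
Definition hopp s : hahn k := Hahn (@hopp_wo s).
Definition hmonom (q : rat) (c : k) : hahn k := Hahn (@hmonom_wo q c).
Definition hmul s t : hahn k := Hahn (@hmul_wo s t).

Fact haddA : associative hadd.
Proof. by move=> s t u; apply: hahnP => q /=; rewrite addrA. Qed.
Fact haddC : commutative hadd.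
Proof. by move=> s t; apply: hahnP => q /=; rewrite addrC. Qed.
Fact hadd0 : left_id hzero hadd.
Proof. by move=> s; apply: hahnP => q /=; rewrite add0r. Qed.
Fact haddN : left_inverse hzero hopp hadd.
Proof. by move=> s; apply: hahnP => q /=; rewrite addNr. Qed.

HB.instance Definition _ :=
  GRing.isZmodule.Build (hahn k) haddA haddC hadd0 haddN.

Lemma hcoef0 q : (0 : hahn k) q = 0. Proof. by []. Qed.
Lemma hcoefD s t q : (s + t) q = s q + t q. Proof. by []. Qed.
Lemma hcoefN s q : (- s) q = - s q. Proof. by []. Qed.
Lemma hcoefB s t q : (s - t) q = s q - t q. Proof. by []. Qed.

Fact hmulC : commutative hmul.
Proof.
move=> s t; apply: hahnP => q /=.
have [r ur hr] := wo_conv_seq q (hsupp_wo s) (hsupp_wo t).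
rewrite (@hmul_coefE s t q r) //; last by move=> a sa ta; apply/hr.
rewrite (@hmul_coefE t s q [seq q - a | a <- r]).
- by rewrite big_map; apply: eq_bigr => a _; rewrite subKr mulrC.
- by rewrite map_inj_uniq // => a b /addrI /oppr_inj.
- move=> a ta sa; apply/mapP; exists (q - a); last by rewrite subKr.
  by apply/hr; rewrite /hsupp /= subKr.
Qed.

Fact hmulA : associative hmul.
Proof.
move=> s t u; apply: hahnP => q /=.
pose A := hsupp s; pose B := hsupp t; pose C := hsupp u.
have [wA wB wC] : [/\ well_ordered A, well_ordered B & well_ordered C].
  by split; apply: hsupp_wo.
have [r1 u1 h1] := wo_conv_seq q (wo_sumset wA wB) wC.
have [r2 u2 h2] := wo_conv_seq q wA (wo_sumset wB wC).
rewrite (@hmul_coefE s _ q r2) //; last first.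
  by move=> b sb /hmul_coef_neq0 ?; apply/h2.
rewrite (@hmul_coefE _ u q r1) //; last first.
  by move=> a /hmul_coef_neq0 ? ?; apply/h1.
pose G b a := s b * t (a - b) * u (q - a).
transitivity (\sum_(b <- r2) \sum_(a <- r1) G b a).
  apply: eq_bigr => b _; have [s0|sb] := eqVneq (s b) 0.
    by rewrite s0 mul0r big1 // => a _; rewrite /G s0 !mul0r.
  rewrite (@hmul_coefE _ _ _ [seq a - b | a <- r1]).
  - rewrite big_map mulr_sumr; apply: eq_bigr => a _.
    by rewrite /G mulrA opprB addrA subrK.
  - by rewrite map_inj_uniq // => a c /addIr.
  - move=> c tc uc; apply/mapP; exists (c + b); last by rewrite addrK.
    apply/h1; split; first by exists b => //; rewrite /B /hsupp /= addrK.
    by rewrite /C /hsupp /= [c + b]addrC opprD addrA.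
rewrite exchange_big; apply: eq_bigr => a _ /=.
have [u0|ua] := eqVneq (u (q - a)) 0.
  by rewrite u0 mulr0 big1 // => b _; rewrite /G u0 mulr0.
rewrite (@hmul_coefE _ _ _ r2) // ?mulr_suml // => b sb tb.
apply/h2; split=> //; exists (a - b) => //.
by rewrite /C /hsupp /= opprB addrA subrK.
Qed.

Lemma hmonom_mulE q c s a : hmul (hmonom q c) s a = c * s (a - q).
Proof.
rewrite /= (@hmul_coefE _ _ _ [:: q]) //; first by rewrite big_seq1 /= eqxx.
by move=> b /=; rewrite inE; case: (b =P q) => //; rewrite eqxx.
Qed.

Fact hmul1 : left_id (hmonom 0 1) hmul.
Proof. by move=> s; apply: hahnP => q; rewrite hmonom_mulE mul1r subr0. Qed.

Fact hmulDl : left_distributive hmul hadd.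
Proof.
move=> s t u; apply: hahnP => q /=.
pose A := hsupp s `|` hsupp t.
have wA : well_ordered A by apply: wo_setU; apply: hsupp_wo.
have [r ur hr] := wo_conv_seq q wA (hsupp_wo u).
rewrite !(@hmul_coefE _ _ q r) //; last 3 first.
- by move=> a ta ua; apply/hr; split=> //; right.
- by move=> a sa ua; apply/hr; split=> //; left.
- move=> a sta ua; apply/hr; split=> //.
  have [s0|] := eqVneq (s a) 0; last by left.
  by right; move: sta; rewrite s0 add0r.
by rewrite -big_split; apply: eq_bigr => a _; rewrite mulrDl.
Qed.

Fact hone_neq0 : hmonom 0 1 != 0.
Proof. by apply/eqP => /(congr1 (fun s : hahn k => s 0)) /= /eqP; rewrite oner_eq0. Qed.

HB.instance Definition _ := GRing.Zmodule_isComNzRing.Build (hahn k)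
  hmulA hmulC hmul1 hmulDl hone_neq0.

Lemma hcoef1 q : (1 : hahn k) q = (q == 0)%:R.
Proof. by rewrite [LHS]/=; case: eqP. Qed.

Lemma hcoefM s t q : (s * t) q = \sum_(a \in [set: rat]) s a * t (q - a).
Proof. by []. Qed.

Lemma hcoefM_neq0 s t q :
  (s * t) q != 0 -> exists2 a, s a != 0 & t (q - a) != 0.
Proof. exact: hmul_coef_neq0. Qed.

Lemma hcoef_monomM q c s a : (hmonom q c * s) a = c * s (a - q).
Proof. exact: hmonom_mulE. Qed.

Lemma hmonomM q c r d : hmonom q c * hmonom r d = hmonom (q + r) (c * d).
Proof.
apply: hahnP => a; rewrite hcoef_monomM /= subr_eq [r + q]addrC.
by case: ifP => // _; rewrite mulr0.
Qed.

Lemma hcoef_sum (I : Type) (r : seq I) (P : pred I) (F : I -> hahn k) q :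
  (\sum_(i <- r | P i) F i) q = \sum_(i <- r | P i) F i q.
Proof. by elim/big_rec2: _ => // i x y _ <-. Qed.

Lemma hcoefX_ge (s : hahn k) (e : rat) n q :
  (forall a, s a != 0 -> e <= a) -> (s ^+ n) q != 0 -> n%:R * e <= q.
Proof.
move=> se; elim: n q => [|n IH] q.
  by rewrite expr0 mul0r hcoef1; case: (q =P 0) => [->|_] //; rewrite eqxx.
rewrite exprS => /hcoefM_neq0[a /se ea /IH].
rewrite lerBrDl; apply: le_trans.
by rewrite -natr1 mulrDl mul1r addrC lerD2r.
Qed.

(* Exponents are archimedean, so each coefficient of the geometric series is
   a coefficient of one of its partial sums. *)
Lemma hgeom_inv (u : hahn k) : (forall a, u a != 0 -> 0 < a) ->
  exists g, (1 - u) * g = 1.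
Proof.
move=> u_gt0; have [u0|/set0P nu] := eqVneq (hsupp u) set0.
  exists 1; rewrite mulr1; suff -> : u = 0 by rewrite subr0.
  apply: hahnP => q; apply/eqP; rewrite -[_ == _]negbK; apply/negP => uq.
  by have : hsupp u q by []; rewrite u0.
have [e [ue le]] := hsupp_wo _ _ (fun _ => id) nu.
have e_gt0 : 0 < e by apply: u_gt0.
pose N (q : rat) := Num.bound (q / e).
pose gn n : hahn k := \sum_(i < n) u ^+ i.
have big0 n q : (N q <= n)%N -> (u ^+ n) q = 0.
  move=> Nn; apply/eqP; rewrite -[_ == _]negbK; apply/negP.
  move=> /hcoefX_ge => /(_ _ le); rewrite -ler_pdivlMr // leNgt => /negP; apply.
  have [q0|q0] := leP 0 (q / e).
    by apply: lt_le_trans (archi_boundP q0) _; rewrite ler_nat.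
  by apply: lt_le_trans q0 _; rewrite ler0n.
have gnE n q : (N q <= n)%N -> gn n q = gn (N q) q.
  elim: n => [|n IH]; first by rewrite leqn0 => /eqP ->.
  rewrite leq_eqVlt => /orP[/eqP -> //|]; rewrite ltnS => Nn.
  by rewrite /gn big_ord_recr hcoefD big0 // addr0 IH.
pose P (q : rat) := Num.bound `|q / e|.
have NP q q' : q' <= q -> gn (P q) q' = gn (N q') q'.
  move=> qq'; have z n : (P q <= n)%N -> (u ^+ n) q' = 0.
    move=> Pn; apply/eqP; rewrite -[_ == _]negbK; apply/negP.
    move=> /hcoefX_ge => /(_ _ le); rewrite -ler_pdivlMr // leNgt => /negP.
    apply; apply: le_lt_trans (_ : q / e < _).
      by rewrite ler_pM2r ?invr_gt0.
    apply: le_lt_trans (ler_norm _) _.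
    by apply: lt_le_trans (archi_boundP (normr_ge0 _)) _; rewrite ler_nat.
  have gP n : gn (P q + n)%N q' = gn (P q) q'.
    elim: n => [|n IH]; first by rewrite addn0.
    by rewrite addnS /gn big_ord_recr hcoefD z ?leq_addr // addr0.
  by rewrite -(gP (N q')) gnE // leq_addl.
have gwo : well_ordered [set q | (fun q => gn (N q) q) q != 0].
  move=> B Bg [b Bb].
  have [m [[Bm mb] lm]] : exists m, least (B `&` [set q | q <= b]) m.
    apply: (hsupp_wo (gn (P b))).
      by move=> x [Bx xb]; rewrite /hsupp /= NP //; apply: Bg.
    by exists b; split=> /=.
  exists m; split=> // x Bx; have [xb|bx] := leP x b; first exact: lm.
  by apply: le_trans (ltW bx).
exists (Hahn gwo); apply: hahnP => q.
transitivity (((1 - u) * gn (P q)) q).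
  rewrite !hcoefM; apply: eq_fsbigr => a _.
  have [->|ua] := eqVneq ((1 - u) a) 0; first by rewrite !mul0r.
  congr (_ * _); rewrite [LHS]/= NP // gerBl.
  move: ua; rewrite hcoefB hcoef1; case: (a =P 0) => [->//|_].
  by rewrite sub0r oppr_eq0 => /u_gt0 /ltW.
have -> : (1 - u) * gn (P q) = 1 - u ^+ P q.
  by rewrite -opprB mulNr -subrX1 opprB.
rewrite hcoefB (_ : (u ^+ P q) q = 0) ?subr0 //.
apply/eqP; rewrite -[_ == _]negbK; apply/negP.
move=> /hcoefX_ge => /(_ _ le); rewrite -ler_pdivlMr // leNgt => /negP; apply.
by apply: le_lt_trans (ler_norm _) (archi_boundP (normr_ge0 _)).
Qed.

Lemma hahn_inv (s : hahn k) : s != 0 -> exists t, t * s = 1.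
Proof.
move=> s0; have ne : hsupp s !=set0.
  apply: contraPP s0 => ne; apply/negP; rewrite negbK; apply/eqP/hahnP => q.
  by apply/eqP; rewrite -[_ == _]negbK; apply/negP => sq; apply: ne; exists q.
have [m [sm lm]] := hsupp_wo _ _ (fun _ => id) ne.
pose y := hmonom (- m) (s m)^-1.
have yE a : (y * s) a = (s m)^-1 * s (a + m).
  by rewrite hcoef_monomM opprK.
have [|g gE] := @hgeom_inv (1 - y * s); last first.
  by exists (g * y); rewrite -mulrA mulrC -[RHS]gE; congr (_ * _); rewrite subKr.
move=> a; rewrite hcoefB hcoef1 yE; have [->|a0] := eqVneq a 0.
  by rewrite add0r mulVf // subrr eqxx.
rewrite sub0r oppr_eq0 mulf_eq0 negb_or => /andP[_ /lm].
by rewrite lerDr le_eqVlt eq_sym (negPf a0).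
Qed.

Definition hinv s : hahn k := xget 0 [set t | t * s = 1].

Fact hmulVf s : s != 0 -> hinv s * s = 1.
Proof. by move=> /hahn_inv; rewrite /hinv => /(xgetPex 0). Qed.

Fact hinv0 : hinv 0 = 0.
Proof.
by apply: xgetPN => t /eqP; rewrite mulr0 eq_sym oner_eq0.
Qed.

HB.instance Definition _ := GRing.ComNzRing_isField.Build (hahn k) hmulVf hinv0.

End HahnRing.

Arguments hsupp_wo {k} s B _ _.

Section Valuation.
Variable k : fieldType.
Implicit Types s : hahn k.

(* The least exponent of the support; the default value serves [s = 0]. *)
Definition hval s : \bar rat := xget +oo%E [set q%:E%E | q in least (hsupp s)].

Lemma hval0 : hval 0 = +oo%E.
Proof. by apply: xgetPN => x [q [+ _] _]; rewrite /hsupp /= eqxx. Qed.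

Lemma hvalE s q : least (hsupp s) q -> hval s = q%:E%E.
Proof.
move=> [sq lq]; apply: xget_unique; first by exists q.
move=> _ [r [sr lr] <-]; congr (_%:E%E).
by apply/eqP; rewrite eq_le lr // lq.
Qed.

Lemma hval_eqy s : (hval s == +oo%E) = (s == 0).
Proof.
apply/eqP/eqP => [|->]; last exact: hval0.
move=> vs; apply: hahnP => q; apply/eqP; rewrite -[_ == _]negbK; apply/negP.
move=> sq; have [|m lm] := hsupp_wo s _ (fun _ => id); first by exists q.
by move: vs; rewrite (hvalE lm).
Qed.

End Valuation.

Section Series.
Variable k : fieldType.
Implicit Types (s t : hahn k) (F : nat -> hahn k).

Definition hconst (c : k) : hahn k := hmonom 0 c.
Definition ypow (q : rat) : hahn k := hmonom q 1.

Definition summable F : Prop :=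
  well_ordered (\bigcup_n hsupp (F n)) /\
  forall q, finite_set [set n | F n q != 0].

(* The sum of a summable family, taken coefficientwise; 0 otherwise. *)
Definition hsum F : hahn k :=
  xget (0 : hahn k)
    [set t : hahn k | summable F /\ forall q, t q = \sum_(n \in [set: nat]) F n q].

(* The p^n-th root of s; it is unique in characteristic p. *)
Definition proot (p n : nat) s : hahn k := xget 0 [set t | t ^+ (p ^ n)%N = s].

(* The index n of the library's sequences starts at 0, hence the n.+1:
   alpha = sum_(n >= 1) y^(-1/p^n) and eta = sum_(n >= 1) alpha^(2/p^n). Both
   families are summable: see alpha_summable and eta_summable below. *)
Definition alpha (p : nat) : hahn k :=
  hsum (fun n => ypow (- (p%:R ^+ n.+1)^-1)).

Definition eta (p : nat) : hahn k := hsum (fun n => proot p n.+1 (alpha p ^+ 2)).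

Lemma hsumE F q : summable F -> hsum F q = \sum_(n \in [set: nat]) F n q.
Proof.
move=> sF; have wF : well_ordered
    [set q | (fun q => \sum_(n \in [set: nat]) F n q) q != 0].
  apply: (wo_sub _ sF.1) => a /=; apply: contra_neqP => nF.
  by apply: fsbig1 => n _; apply: contra_notP nF => /eqP Fn; exists n.
have [|_ ->//] := @xgetPex _ (0 : hahn k) [set t : hahn k | summable F /\
    forall q, t q = \sum_(n \in [set: nat]) F n q].
by exists (Hahn wF).
Qed.

Lemma fsum_nat_ord (G : nat -> k) : finite_set [set n | G n != 0] ->
  exists N, forall n, (N <= n)%N ->
    \sum_(i \in [set: nat]) G i = \sum_(i < n) G i.
Proof.
move=> /finite_seqP[r rE]; exists (\max_(i <- r) i.+1)%N => n rn.
rewrite -(big_mkord predT) (fsbigE (index_iota 0 n)) ?iota_uniq //.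
  by apply: eq_bigl => i; rewrite in_setT.
move=> i _; apply: contraNeq => Gi.
have ir : i \in r by rewrite -[is_true _]/([set` r] i) -rE.
rewrite mem_index_iota /=; apply: leq_trans rn.
by rewrite (big_rem i) //= leq_maxl.
Qed.

Lemma finite_nat_bounded (P : set nat) N :
  (forall n, P n -> (n < N)%N) -> finite_set P.
Proof. by move=> PN; apply: sub_finite_set (finite_II N). Qed.

Lemma hmonomX q c n : hmonom q c ^+ n = hmonom (n%:R * q) (c ^+ n) :> hahn k.
Proof.
elim: n => [|n IH]; first by rewrite !expr0 mul0r.
by rewrite !exprS IH hmonomM -[in RHS]natr1 mulrDl mul1r [q + _]addrC.
Qed.

Lemma hcoefX_gt s (e : rat) n q :
  (forall a, s a != 0 -> e < a) -> (s ^+ n.+1) q != 0 -> n.+1%:R * e < q.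
Proof.
move=> se; elim: n q => [|n IH] q.
  by rewrite expr1 mul1r; apply: se.
rewrite exprS => /hcoefM_neq0[a /se ea /IH].
rewrite ltrBrDl; apply: le_lt_trans.
by rewrite -[n.+2%:R]natr1 mulrDl mul1r addrC lerD2r ltW.
Qed.

Lemma hcoefX_lt s (e : rat) n q :
  (forall a, s a != 0 -> a < e) -> (s ^+ n.+1) q != 0 -> q < n.+1%:R * e.
Proof.
move=> se; elim: n q => [|n IH] q.
  by rewrite expr1 mul1r; apply: se.
rewrite exprS => /hcoefM_neq0[a /se ea /IH].
rewrite ltrBlDl => /lt_le_trans; apply.
by rewrite -[n.+2%:R]natr1 mulrDl mul1r addrC lerD2l ltW.
Qed.

Fact htrunc_wo (P : pred rat) s :
  well_ordered [set q | (fun q => if P q then s q else 0) q != 0].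
Proof.
by apply: (wo_sub _ (hsupp_wo s)) => q /=; case: ifP; rewrite ?eqxx.
Qed.
Definition htrunc (P : pred rat) s : hahn k := Hahn (@htrunc_wo P s).

Lemma hcoefMn s n q : (s *+ n) q = s q *+ n.
Proof. by elim: n => // n IH; rewrite !mulrS hcoefD IH. Qed.

Section Char.
Variables (p : nat) (charp : p \in [pchar k]).

Let p_pr : prime p. Proof. exact: pcharf_prime charp. Qed.
Let p_gt0 : (0 < p)%N. Proof. exact: prime_gt0. Qed.

Lemma pchar_hahn : p \in [pchar (hahn k)].
Proof.
rewrite inE /= p_pr; apply/eqP/hahnP => q.
by rewrite hcoefMn -mulr_natr (pcharf0 charp) mulr0.
Qed.

Let p_neq0 : p%:R != 0 :> rat.
Proof. by rewrite pnatr_eq0 -lt0n. Qed.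

Lemma hexpDp s t m : (s + t) ^+ (p ^ m)%N = s ^+ (p ^ m)%N + t ^+ (p ^ m)%N.
Proof.
apply: exprDn_pchar; rewrite (eq_pnat _ (pcharf_eq pchar_hahn)).
by rewrite pnatX pnat_id.
Qed.

Lemma hexp_inj m : injective (fun s => s ^+ (p ^ m)%N).
Proof.
move=> s t /= st; apply/eqP; rewrite -subr_eq0.
have : (s - t) ^+ (p ^ m)%N == 0.
  rewrite -(inj_eq (addIr (t ^+ (p ^ m)%N))) -hexpDp subrK add0r.
  exact/eqP.
by rewrite expf_eq0 => /andP[].
Qed.

Lemma hcoefXp s q : (s ^+ p) q = s (q / p%:R) ^+ p.
Proof.
pose x := q / p%:R; have qE : p%:R * x = q by rewrite mulrC divfK.
pose l := htrunc (fun a => a < x) s; pose r := htrunc (fun a => x < a) s.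
have sE : s = hmonom x (s x) + (l + r).
  apply: hahnP => a; rewrite !hcoefD /=.
  by case: (ltgtP a x) => [||->]; rewrite ?add0r ?addr0.
have := hexpDp (hmonom x (s x)) (l + r) 1.
rewrite [in X in _ = _ + X]hexpDp expn1 -sE => ->.
rewrite !hcoefD hmonomX qE /= eqxx -/x.
have -> : (l ^+ p) q = 0.
  apply/eqP; rewrite -[_ == _]negbK; apply/negP; rewrite -(prednK p_gt0).
  move=> /(@hcoefX_lt _ x); rewrite prednK // qE ltxx => H.
  by suff: false by []; apply: H => a /=; case: ifP => //; rewrite eqxx.
have -> : (r ^+ p) q = 0.
  apply/eqP; rewrite -[_ == _]negbK; apply/negP; rewrite -(prednK p_gt0).
  move=> /(@hcoefX_gt _ x); rewrite prednK // qE ltxx => H.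
  by suff: false by []; apply: H => a /=; case: ifP => //; rewrite eqxx.
by rewrite !addr0.
Qed.

Lemma hcoefXpn s m q : (s ^+ (p ^ m)%N) q = s (q / p%:R ^+ m) ^+ (p ^ m)%N.
Proof.
elim: m q => [|m IH] q; first by rewrite expn0 !expr1 expr0 divr1.
rewrite expnSr exprM hcoefXp IH -exprM; congr (s _ ^+ _).
by rewrite exprSr invfM mulrA mulrAC.
Qed.

Lemma sum_telescope F s : summable F -> F 0%N ^+ p = s ->
  (forall n, F n.+1 ^+ p = F n) -> hsum F ^+ p - hsum F = s.
Proof.
move=> sF F0 FS; apply/eqP; rewrite subr_eq; apply/eqP/hahnP => q.
rewrite hcoefXp hcoefD !hsumE //.
have [N1 h1] := fsum_nat_ord (sF.2 (q / p%:R)).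
have [N2 h2] := fsum_nat_ord (sF.2 q).
rewrite (h1 (maxn N1 N2).+1) ?leqW ?leq_maxl // (h2 (maxn N1 N2)) ?leq_maxr //.
have -> (n : nat) (G : 'I_n -> k) : (\sum_i G i) ^+ p = \sum_i G i ^+ p.
  elim/big_rec2: _ => [|i y z _ <-]; first by rewrite expr0n (gtn_eqF p_gt0).
  by rewrite -!(pFrobenius_autE charp) rmorphD.
rewrite big_ord_recl -hcoefXp F0; congr (_ + _).
by apply: eq_bigr => i _; rewrite -hcoefXp FS.
Qed.

Definition pexp_set : set rat :=
  [set q | exists n : nat, q = - (p%:R ^+ n.+1)^-1].

Lemma pexp_gt0 n : 0 < p%:R ^+ n :> rat.
Proof. by rewrite exprn_gt0 // ltr0n. Qed.

Lemma pexp_bound n : n%:R < p%:R ^+ n :> rat.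
Proof. by rewrite -natrX ltr_nat; apply/ltn_expl/prime_gt1. Qed.

Lemma pexp_set_wo : well_ordered pexp_set.
Proof.
move=> B Bp [b Bb].
have [n0 En0] := Bp _ Bb.
have ex : exists n, `[< B (- (p%:R ^+ n.+1)^-1) >].
  by exists n0; rewrite -En0; apply/asboolP.
exists (- (p%:R ^+ (ex_minn ex).+1)^-1).
case: ex_minnP => m /asboolP Bm lm; split=> // x Bx.
have [n xE] := Bp _ Bx; rewrite xE lerN2 lef_pV2 ?posrE ?pexp_gt0 //.
rewrite -!natrX ler_nat leq_exp2l ?prime_gt1 //= ltnS.
by apply: lm; apply/asboolP; rewrite -xE.
Qed.

Lemma alpha_summable : summable (fun n => ypow (- (p%:R ^+ n.+1)^-1)).
Proof.
split.
  apply: (wo_sub _ pexp_set_wo) => q [n _].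
  by rewrite /hsupp /=; case: ifP => [/eqP ->|_]; [exists n | rewrite eqxx].
move=> q; apply: (@finite_nat_bounded _ (Num.bound `|q^-1|)) => n /=.
case: ifP => [/eqP -> _|_]; last by rewrite eqxx.
rewrite invrN invrK normrN gtr0_norm ?pexp_gt0 //.
apply: ltnW; rewrite -(ltr_nat rat).
by apply: lt_trans (pexp_bound _) (archi_boundP (ltW (pexp_gt0 _))).
Qed.

Lemma alpha_AS : alpha p ^+ p - alpha p = ypow (- 1).
Proof.
apply: sum_telescope; first exact: alpha_summable.
  by rewrite hmonomX expr1n expr1 mulrN divff.
move=> n; rewrite hmonomX expr1n; congr hmonom.
by rewrite mulrN exprS invfM mulrA divff // mul1r.
Qed.

Lemma alpha_supp : hsupp (alpha p) `<=` pexp_set.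
Proof.
move=> q; rewrite /hsupp /= hsumE; last exact: alpha_summable.
apply: contra_neqP => nq; apply: fsbig1 => n _ /=.
by case: ifP => // /eqP qE; exfalso; apply: nq; exists n.
Qed.

End Char.
End Series.

Section ClosedSeries.
Variables (k : closedFieldType) (p : nat) (charp : p \in [pchar k]).

Let p_pr : prime p. Proof. exact: pcharf_prime charp. Qed.
Let p_gt0 : (0 < p)%N. Proof. exact: prime_gt0. Qed.
Let p_neq0 : p%:R != 0 :> rat.
Proof. by rewrite pnatr_eq0 -lt0n. Qed.

Lemma prootK n (s : hahn k) : proot p n s ^+ (p ^ n)%N = s.
Proof.
have pn_gt0 : (0 < p ^ n)%N by rewrite expn_gt0 p_gt0.
have /choice[f fE] : forall q, exists c : k, c ^+ (p ^ n)%N = s (q * p%:R ^+ n).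
  move=> q.
  have [c cE] := @solve_monicpoly k (p ^ n)%N
    (fun i => if i == 0%N then s (q * p%:R ^+ n) else 0) pn_gt0.
  exists c; rewrite cE; case: (p ^ n)%N pn_gt0 => // m _.
  by rewrite big_ord_recl /= expr0 mulr1 big1 ?addr0 // => i _; rewrite mul0r.
have wf : well_ordered [set q | f q != 0].
  move=> B Bf [b Bb].
  have [m [[x Bx xm] lm]] :
      exists m, least [set q * p%:R ^+ n | q in B] m.
    apply: (hsupp_wo s); last by exists (b * p%:R ^+ n), b.
    by move=> _ [x /Bf /= fx <-]; rewrite /hsupp /= -fE expf_neq0.
  exists x; split=> // y By; have := lm (y * p%:R ^+ n).
  rewrite -xm ler_pM2r ?exprn_gt0 ?ltr0n //; apply.
  by exists y.
rewrite /proot; apply: (@xgetPex _ 0 [set t | t ^+ (p ^ n)%N = s]).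
exists (Hahn wf) => /=; apply: hahnP => q.
by rewrite hcoefXpn // fE divfK // expf_neq0.
Qed.

Lemma eta_summable :
  summable (fun n => proot p n.+1 (alpha k p ^+ 2)).
Proof.
have pe := pexp_gt0 charp.
have sub n q : proot p n.+1 (alpha k p ^+ 2) q != 0 -> exists a b,
    [/\ pexp_set p a, pexp_set p b & q = (a + b) / p%:R ^+ n.+1].
  move=> nz; have : (alpha k p ^+ 2) (q * p%:R ^+ n.+1) != 0.
    rewrite -[alpha k p ^+ 2](prootK n.+1).
    by rewrite hcoefXpn // mulfK ?expf_neq0.
  rewrite expr2 => /hcoefM_neq0[a aA bA].
  exists a, (q * p%:R ^+ n.+1 - a); split; try exact: (alpha_supp charp).
  by rewrite addrC subrK mulfK // expf_neq0.
have divA n a : pexp_set p a -> pexp_set p (a / p%:R ^+ n.+1).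
  move=> [i ->]; exists (n.+1 + i)%N.
  by rewrite mulNr -invfM -exprD addSn addnC.
split.
  apply: (wo_sub _ (wo_sumset (pexp_set_wo charp) (pexp_set_wo charp))).
  move=> q [n _ /sub [a [b [aA bA ->]]]] /=.
  exists (a / p%:R ^+ n.+1); first exact: divA.
  by rewrite mulrDl addrC addKr; apply: divA.
move=> q; apply: (@finite_nat_bounded _ (Num.bound (2 * `|q^-1|))) => n /=.
move=> /sub [a [b [[i ->] [j ->] ->]]].
have le1 m : (p%:R ^+ m)^-1 <= 1 :> rat.
  by rewrite invf_le1 // -natrX ler1n expn_gt0 p_gt0.
rewrite -opprD mulNr invrN normrN invf_div gtr0_norm; last first.
  by rewrite divr_gt0 ?addr_gt0 ?invr_gt0.
set e := (p%:R ^+ i.+1)^-1 + _.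
have e_gt0 : 0 < e by rewrite addr_gt0 ?invr_gt0.
have e_le2 : e <= 2 by apply: lerD.
apply: ltnW; rewrite -(ltr_nat rat).
apply: lt_trans (pexp_bound charp _) _.
apply: le_lt_trans (archi_boundP _); last first.
  by rewrite mulr_ge0 // divr_ge0 // ltW.
rewrite mulrCA; apply: ler_peMr; first exact: ltW.
by rewrite ler_pdivlMr // mul1r.
Qed.

Lemma eta_AS : eta k p ^+ p - eta k p = alpha k p ^+ 2.
Proof.
apply: (sum_telescope charp); first exact: eta_summable.
  by have := prootK 1 (alpha k p ^+ 2).
move=> n; apply: (hexp_inj charp (m := n.+1)) => /=.
by rewrite -exprM -expnS !prootK.
Qed.

End ClosedSeries.

Section Subfields.
Variable F : fieldType.
Implicit Types (K A : set F) (x : F).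

Definition is_subfield K : Prop := GRing.divring_closed [in K].

Definition gen_subfield A : set F := smallest is_subfield A.

Definition adjoin K x : set F := gen_subfield (K `|` [set x]).

(* [deg_is K x n]: x is algebraic over K and its minimal polynomial over K has
   degree n. *)
Definition deg_is K x (n : nat) : Prop :=
  least [set (size f).-1 | f in [set f : {poly F} |
           [/\ f \is a polyOver [in K], f != 0 & root f x]]] n.

(* Perfectness of a field K of characteristic p. *)
Definition perfect (p : nat) K : Prop :=
  forall a, K a -> exists2 b, K b & b ^+ p = a.

Lemma deg_is_uniq K x m n : deg_is K x m -> deg_is K x n -> m = n.
Proof. by move=> [Am lm] [An ln]; apply/eqP; rewrite eq_le lm // ln. Qed.

Lemma deg_is_gt0 K x n : deg_is K x n -> (0 < n)%N.
Proof.
move=> [[f [_ f0 fx] <-] _]; have := root_size_gt1 f0 fx.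
by case: (size f) => [|[]].
Qed.

End Subfields.

Section ValuedSubfields.
Variable k : fieldType.
Implicit Types K M : set (hahn k).

(* The subfield k(y): generated by the constants and y. *)
Definition rat_subfield : set (hahn k) :=
  gen_subfield (range (@hconst k) `|` [set ypow k 1]).

Definition val_ring K : set (hahn k) := [set a | K a /\ (0%:E <= hval a)%E].

(* When K contains k, the residue field of K is k and the residue class of
   [a] in [val_ring K] is the coefficient [a 0]. *)
Definition residue_poly (f : {poly hahn k}) : {poly k} :=
  map_poly (fun a : hahn k => a 0) f.

(* The valuation ring of K satisfies Hensel's lemma. *)
Definition henselian K : Prop :=
  forall (f : {poly hahn k}) (g0 h0 : {poly k}),
    f \is monic -> f \is a polyOver [in val_ring K] ->
    g0 \is monic -> h0 \is monic -> coprimep g0 h0 ->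
    residue_poly f = g0 * h0 ->
    exists g h : {poly hahn k},
      [/\ g \is monic, g \is a polyOver [in val_ring K],
          h \is monic & h \is a polyOver [in val_ring K]] /\
      [/\ f = g * h, residue_poly g = g0 & residue_poly h = h0].

Definition no_finite_limits (R : realType) K : Prop :=
  forall a, K a -> limit_point [set (ratr q : R) | q in hsupp a] = set0.

Definition dist_set K (theta : hahn k) (m : nat) : set (\bar rat) :=
  [set hval (theta - b) | b in [set b | deg_is K b m]].

(* [depth_step K theta d m]: if d is a term of the sequence d_0 < d_1 < ...
   attached to theta, then m is the next one. It does not exist when d is the
   degree of theta, since the set for d then contains +oo. *)
Definition depth_step K theta (d m : nat) : Prop :=
  least [set m : nat | (d < m)%N /\
    exists2 e, dist_set K theta m e &
               forall x, dist_set K theta d x -> (x < e)%E] m.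

(* A functional relation on algebraic theta: see depth_is_uniq, depth_is_ex. *)
Definition depth_is K theta (r : nat) : Prop :=
  exists d : nat -> nat,
    [/\ d 0%N = 1%N,
        forall l, (l < r)%N -> depth_step K theta (d l) (d l.+1)
      & deg_is K theta (d r)].

(* depth(M/K) = r, a minimum over the generators theta of M over K. *)
Definition ext_depth_is K M (r : nat) : Prop :=
  least [set r : nat | exists2 theta, M = adjoin K theta & depth_is K theta r] r.

Lemma depth_is_uniq K theta r r' :
  depth_is K theta r -> depth_is K theta r' -> r = r'.
Proof.
wlog : r r' / (r <= r')%N => [H|].
  by case/orP: (leq_total r r') => rr dr dr'; [|apply/esym]; apply: H.
rewrite leq_eqVlt => /orP[/eqP //|rr] [d [d0 dS dn]] [d' [d'0 d'S d'n]].
have dd l : (l <= r)%N -> d l = d' l.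
  elim: l => [|l IH lr]; first by rewrite d0 d'0.
  have [A1 l1] := dS l lr; have [A2 l2] := d'S l (ltn_trans lr rr).
  rewrite -IH ?(ltnW lr) // in A2 l2.
  by apply/eqP; rewrite eq_le l1 // l2.
have [[_ [e _ He]] _] := d'S r rr.
have := He (hval (theta - theta)); rewrite -dd // => /(_ _).
rewrite subrr hval0 => H.
have : (+oo < e)%E by apply: H; exists theta => //; rewrite subrr hval0.
by rewrite ltNge leey.
Qed.

Lemma depth_is_ex K theta n : deg_is K theta n -> exists r, depth_is K theta r.
Proof.
move=> dn; have n_gt0 := deg_is_gt0 dn.
suff H m : forall d0, (d0 <= n <= d0 + m)%N -> exists r (d : nat -> nat),
    [/\ d 0%N = d0, forall l, (l < r)%N -> depth_step K theta (d l) (d l.+1)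
      & deg_is K theta (d r)].
  by apply: (H n); rewrite n_gt0 leq_addl.
elim: m => [|m IH] d0 /andP[d0n nd].
  exists 0%N, (fun _ => n); split=> //.
  by apply/eqP; rewrite eqn_leq d0n -[d0]addn0 nd.
move: d0n; rewrite leq_eqVlt => /orP[/eqP ->|d0n].
  by exists 0%N, (fun _ => n).
pose S : set nat := [set m | (d0 < m)%N /\
    exists2 e, dist_set K theta m e &
               forall x, dist_set K theta d0 x -> (x < e)%E].
have Sn : S n.
  split=> //; exists +oo%E.
    by exists theta => //; rewrite subrr hval0.
  move=> _ [b db <-]; rewrite lt_neqAle leey andbT hval_eqy subr_eq0.
  apply: contraTneq d0n => tb; rewrite -leqNgt.
  by rewrite (deg_is_uniq db (n := n)) // -tb.
have exS : exists m, `[< S m >] by exists n; apply/asboolP.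
have step : depth_step K theta d0 (ex_minn exS).
  case: ex_minnP => m' /asboolP Sm lm; split=> // x Sx.
  by apply: lm; apply/asboolP.
have ltS : (d0 < ex_minn exS)%N by case: step => [[]].
have leS : (ex_minn exS <= n)%N.
  by case: ex_minnP => m' _; apply; apply/asboolP.
have [|r [d [d1 dS dr]]] := IH (ex_minn exS).
  by rewrite leS (leq_trans nd) // addnS -addSn leq_add2r.
exists r.+1, (fun l => if l is l'.+1 then d l' else d0); split=> // -[|l] //.
  by rewrite d1.
by rewrite ltnS; apply: dS.
Qed.

End ValuedSubfields.

Arguments rat_subfield k _ : clear implicits.

(* Main.v *)
(* The tower K < L = K(alpha) < M = L(eta) consists of Artin-Schreier steps, and
   elements x, x' killed by the same polynomials over the Henselian field K have
   the same value. So if th generates an Artin-Schreier extension of E, then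
   v(th - b) < 0 for all b in E, since the conjugate th + 1 of th would otherwise
   have the same residue as th relative to b.
   Write u_n = alpha^(1/p^n), which lies in alpha + K and has value -1/p^(n+1).
   The elements of K approximate eta up to values arbitrarily close to, but below,
   -1/p^2; the partial sums of eta, which lie in L, up to values close to 0. An
   element b with v(eta - b) >= -1/p^2 approximates alpha up to value 0 within
   K(b), hence K(b) contains alpha; if v(eta - b) >= 0, it contains eta too. So
   the sequence attached to eta is 1, p, p^2, and eta has depth 2.
   Conversely an immediacy argument writes any generator th of M as
   s (eta + e + m) with s in K, e in L and v(m) > 0. If K approximated th as well
   as L does, then it would approximate eta + e up to values close to 0. With
   alpha |-> alpha + 1 one gets d in L such that v(d + 2 zeta) >= 0, where
   zeta = sum_n u_n, and then an element of K whose coefficients at the exponents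
   -1/p^n tending to 0 do not vanish eventually: this contradicts the absence of
   finite limits. So the second term of the sequence of th is at most p, while
   the degree of th is p^2. *)
From HB Require Import structures.
Require Import Defs.
From mathcomp Require Import all_boot all_order all_algebra.
From mathcomp Require Import boolp classical_sets.
From mathcomp Require Import reals constructive_ereal topology num_topology.
From mathcomp Require Import ring.

Set Implicit Arguments.
Unset Strict Implicit.
Unset Printing Implicit Defensive.

Import Order.TTheory GRing.Theory Num.Theory.
Import numFieldTopology.Exports.

Local Open Scope classical_set_scope.
Local Open Scope ring_scope.

(** * Simple extensions of subfields and Artin-Schreier theory *)

Section SubfieldType.
Variables (U : fieldType) (E : divringClosed U).

(** Packing the members of [E] into a field type gives access to polynomial division and matrix rank
    with coefficients in [E]. *)
Record subfield_of := SubfieldOf {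
  subf_val : U;
  subf_valP : subf_val \in E
}.

HB.instance Definition _ := [isSub for subf_val].
HB.instance Definition _ := [Choice of subfield_of by <:].
HB.instance Definition _ := [SubChoice_isSubIntegralDomain of subfield_of by <:].
HB.instance Definition _ := [SubIntegralDomain_isSubField of subfield_of by <:].

End SubfieldType.

Section Subfield.
Variables (U : fieldType) (E : divringClosed U).
Implicit Types (f g : {poly U}) (x y b : U).

Local Notation FE := (subfield_of E).
Local Notation iota := (val : FE -> U).
Local Notation "f ^E" := (map_poly iota f) (at level 2).

Lemma polyOver_lift f : f \is a polyOver E -> exists g : {poly FE}, f = g ^E.
Proof.
move=> /polyOverP fE.
exists (\poly_(i < size f) SubfieldOf (fE i)).
apply/polyP => i; rewrite coef_map coef_poly /=.
by case: ltnP => [//|h]; rewrite nth_default.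
Qed.

Lemma polyOver_map (g : {poly FE}) : g ^E \is a polyOver E.
Proof. by apply/polyOverP => i; rewrite coef_map; exact: subf_valP. Qed.

Lemma polyOver_modr f g : f \is a polyOver E -> g \is a polyOver E -> g != 0 ->
  exists q r, [/\ q \is a polyOver E, r \is a polyOver E,
                  f = q * g + r & (size r < size g)%N].
Proof.
move=> /polyOver_lift[f' ->] /polyOver_lift[g' ->] g0.
exists (f' %/ g') ^E, (f' %% g') ^E; split; try exact: polyOver_map.
  by rewrite {1}(divp_eq f' g') rmorphD rmorphM.
by rewrite !size_map_poly ltn_modp -(map_poly_eq0 iota).
Qed.

Definition algebraic_over : {pred U} := [pred x | `[< algebraicOver iota x >]].

Lemma algebraic_overP x :
  reflect (exists f, [/\ f \is a polyOver E, f != 0 & root f x])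
          (x \in algebraic_over).
Proof.
apply: (iffP (asboolP _)) => [[f f0 fx]|[f [/polyOver_lift[g ->] g0 gx]]].
  by exists f ^E; rewrite polyOver_map map_poly_eq0.
by exists g => //; rewrite -(map_poly_eq0 iota).
Qed.

Fact algebraic_over_divring : divring_closed algebraic_over.
Proof.
have aP x : reflect (algebraicOver iota x) (x \in algebraic_over).
  exact: asboolP.
split=> [|x y /aP hx /aP hy|x y /aP hx /aP hy]; apply/aP.
- exact: (algebraic1 (val : {rmorphism FE -> U})).
- exact: (algebraic_sub hx hy).
- exact: (algebraic_div hx hy).
Qed.

HB.instance Definition _ :=
  GRing.isDivringClosed.Build U algebraic_over algebraic_over_divring.

Lemma sub_algebraic x : x \in E -> x \in algebraic_over.
Proof.
move=> xE; apply/asboolP.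
exact: (algebraic_id (val : {rmorphism FE -> U}) (SubfieldOf xE)).
Qed.

(** The coordinate matrix of the [x i] has more rows than columns, so its left kernel contains a
    nonzero row: the required relation. *)
Lemma linear_dep (I : finType) m (v : 'I_m -> U) (x : I -> U) :
  (forall i, exists2 a : 'I_m -> U, forall j, a j \in E & x i = \sum_j a j * v j) ->
  (m < #|I|)%N ->
  exists c : I -> U, [/\ forall i, c i \in E, exists i, c i != 0
                        & \sum_i c i * x i = 0].
Proof.
move=> xv mI.
have /choice[a aP] : forall i, exists a : 'I_m -> FE,
    x i = \sum_j iota (a j) * v j.
  by move=> i; have [a aE xE] := xv i; exists (fun j => SubfieldOf (aE j)).
pose A : 'M[FE]_(#|I|, m) := \matrix_(i, j) a (enum_val i) j.
have : kermx A != 0.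
  by rewrite kermx_eq0 /row_free neq_ltn (leq_ltn_trans (rank_leq_col A)).
move=> /rowV0Pn[w /sub_kermxP wA w0].
exists (fun i => iota (w 0 (enum_rank i))); split.
- by move=> i; apply: subf_valP.
- have [j wj] : exists j, w 0 j != 0.
    apply/existsP; rewrite -negb_forall; apply: contra w0 => /forallP h.
    by apply/eqP/rowP => j; rewrite mxE; apply/eqP.
  by exists (enum_val j); rewrite enum_valK fmorph_eq0.
- under eq_bigr => i _ do rewrite aP mulr_sumr.
  rewrite exchange_big big1 // => j _ /=.
  under eq_bigr => i _ do rewrite mulrA.
  rewrite -mulr_suml (reindex (@enum_val I predT)) /=; last first.
    by apply: onW_bij; apply: enum_val_bij.
  have := congr1 (fun M : 'M_(1, m) => iota (M 0 j)) wA; rewrite !mxE rmorph0.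
  rewrite rmorph_sum => h; rewrite -[RHS](mul0r (v j)); congr (_ * _).
  rewrite -[RHS]h; apply: eq_bigr => i _; rewrite rmorphM /= mxE.
  by rewrite (enum_valK i).
Qed.

(** This is the ring [E[b]]; for algebraic [b] it is the field [E(b)], by [simple_ext_divring]. *)
Definition simple_ext b : {pred U} :=
  [pred x | `[< exists2 f, f \is a polyOver E & x = f.[b] >]].

Lemma simple_extP b x :
  reflect (exists2 f, f \is a polyOver E & x = f.[b]) (x \in simple_ext b).
Proof. exact: asboolP. Qed.

Lemma sub_simple_ext b x : x \in E -> x \in simple_ext b.
Proof.
by move=> xE; apply/simple_extP; exists x%:P; rewrite ?polyOverC ?hornerC.
Qed.

Lemma gen_simple_ext b : b \in simple_ext b.
Proof. by apply/simple_extP; exists 'X; rewrite ?polyOverX ?hornerX. Qed.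

Lemma simple_ext_algebraic b x : b \in algebraic_over -> x \in simple_ext b ->
  x \in algebraic_over.
Proof.
move=> ab /simple_extP[f /polyOverP fE ->]; rewrite horner_coef.
apply: rpred_sum => i _; apply: rpredM; first exact/sub_algebraic.
exact: rpredX.
Qed.

Fact simple_ext_divring b : b \in algebraic_over -> divring_closed (simple_ext b).
Proof.
move=> ab; split=> [|x y|x y].
- exact/sub_simple_ext/rpred1.
- move=> /simple_extP[f fE ->] /simple_extP[g gE ->].
  by apply/simple_extP; exists (f - g); rewrite ?rpredB // hornerD hornerN.
move=> /simple_extP[f fE ->] yb; have [->|y0] := eqVneq y 0.
  by rewrite invr0 mulr0; apply/sub_simple_ext/rpred0.
have /algebraic_overP[P [PE P0 Py]] := simple_ext_algebraic ab yb.
have /simple_extP[g gE yE] := yb.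
suff [h hE hy] : exists2 h, h \is a polyOver E & y^-1 = h.[y].
  apply/simple_extP; exists (f * (h \Po g)); first by rewrite rpredM ?polyOver_comp.
  by rewrite hornerM horner_comp -yE hy.
(* Induction on a polynomial [P = Q X + c] killing [y]: if [c = 0] then [Q] already kills [y],
   otherwise [y^-1 = - Q(y) / c]. *)
elim/poly_ind: P PE P0 Py => [_|Q c IH PE]; first by rewrite eqxx.
have cE : c \in E.
  by move/polyOverP: PE => /(_ 0%N); rewrite coefD coefMX coefC add0r.
have QE : Q \is a polyOver E.
  apply/polyOverP => i; move/polyOverP: PE => /(_ i.+1).
  by rewrite coefD coefMX coefC addr0.
have [->|c0] := eqVneq c 0.
  rewrite polyC0 addr0 mulf_eq0 polyX_eq0 orbF => Q0.
  by rewrite rootM rootX (negPf y0) orbF; apply: IH.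
move=> _ /rootP; rewrite hornerD hornerM hornerX hornerC => Py.
exists ((- c^-1) *: Q); first by rewrite polyOverZ // rpredN rpredV.
rewrite hornerZ mulNr; apply: (mulIf y0); rewrite mulVf //.
apply: (mulfI c0); move/eqP: Py; rewrite addr_eq0 mulr1 mulNr mulrN -mulrA mulVKf //.
by move=> /eqP ->; rewrite opprK.
Qed.

Lemma simple_ext_reduce b g x : g \is a polyOver E -> g != 0 -> root g b ->
  x \in simple_ext b ->
  exists f, [/\ f \is a polyOver E, (size f < size g)%N & x = f.[b]].
Proof.
move=> gE g0 /rootP gb /simple_extP[f fE ->].
have [q [r [_ rE -> rg]]] := polyOver_modr fE gE g0.
by exists r; split=> //; rewrite hornerD hornerM gb mulr0 add0r.
Qed.

Lemma simple_ext_root_bound (I : finType) b g (x : I -> U) :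
  g \is a polyOver E -> g != 0 -> root g b ->
  (forall i, x i \in simple_ext b) -> ((size g).-1 < #|I|)%N ->
  exists c : I -> U, [/\ forall i, c i \in E, exists i, c i != 0
                        & \sum_i c i * x i = 0].
Proof.
move=> gE g0 gb xb; apply: (@linear_dep _ _ (fun j => b ^+ j)) => i.
have [f [/polyOverP fE fg ->]] := simple_ext_reduce gE g0 gb (xb i).
exists (fun j : 'I__ => f`_j) => //.
by apply: horner_coef_wide; rewrite -ltnS (ltn_predK fg).
Qed.

(** The proof of algebraicity is an argument so that the closure instance can be attached to a term
    that carries it. *)
Definition ext_pred b of b \in algebraic_over := simple_ext b.
HB.instance Definition _ b (ab : b \in algebraic_over) :=
  GRing.isDivringClosed.Build U (ext_pred ab) (simple_ext_divring ab).

End Subfield.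

(** * Degrees over a subfield given as a set *)

Section Degree.
Variables (U : fieldType) (K : set U) (hK : is_subfield K).

Definition subfield_pred of is_subfield K : {pred U} := [in K].
HB.instance Definition _ := GRing.isDivringClosed.Build U (subfield_pred hK) hK.
Local Notation E := (subfield_pred hK : divringClosed U).

Lemma subfield_predE x : (x \in subfield_pred hK) = (x \in K).
Proof. by []. Qed.

Lemma mem_subfield_pred x : x \in subfield_pred hK <-> K x.
Proof. by rewrite subfield_predE inE. Qed.

Lemma adjoinE b : b \in algebraic_over E ->
  forall x, adjoin K b x <-> x \in simple_ext E b.
Proof.
move=> ab x; split=> [|/simple_extP[f /polyOverP fE ->] A [hA KA]].
  have sub : adjoin K b `<=` [set` simple_ext E b].
    apply: smallest_sub.
      have [h1 h2 h3] := simple_ext_divring ab.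
      by split=> [|u v|u v]; rewrite !in_setE; [|exact: h2|exact: h3].
    move=> y [/mem_subfield_pred yK|->]; first exact: sub_simple_ext.
    exact: gen_simple_ext.
  exact: sub.
have [A1 AB AD] := hA.
have A0 : 0 \in A by rewrite -(subrr 1); apply: AB.
have AN y : y \in A -> - y \in A by rewrite -sub0r; apply: AB.
have AP y z : y \in A -> z \in A -> y + z \in A.
  by move=> yA zA; rewrite -[z]opprK; apply: AB => //; apply: AN.
have AM y z : y \in A -> z \in A -> y * z \in A.
  move=> yA zA; rewrite -[z]invrK; apply: (AD) => //.
  by rewrite -[z^-1]mul1r; apply: AD.
have {}KA y : y \in (K `|` [set b]) -> y \in A by rewrite !in_setE; apply: KA.
rewrite -in_setE horner_coef.
elim/big_ind: _ => // i _; apply: (AM).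
  by apply: KA; rewrite in_setE; left; exact/mem_subfield_pred/fE.
elim: (nat_of_ord i) => [|n IH]; rewrite ?expr0 // exprS; apply: AM => //.
by apply: KA; rewrite in_setE; right.
Qed.

Lemma deg_is_le b g : g \is a polyOver E -> g != 0 -> root g b ->
  exists2 n, deg_is K b n & (n <= (size g).-1)%N.
Proof.
move=> gE g0 gb.
pose P n := `[< exists f,
  [/\ f \is a polyOver E, f != 0, root f b & (size f).-1 = n] >].
have exP : exists n, P n by exists (size g).-1; apply/asboolP; exists g.
exists (ex_minn exP); case: ex_minnP => n /asboolP[f [fE f0 fb <-]] minn.
  split; first by exists f.
  by move=> _ [h [hE h0 hb] <-]; apply: minn; apply/asboolP; exists h.
by apply: minn; apply/asboolP; exists g.
Qed.

(** The lower bounds [p] and [p ^ 2] on degrees come from here: [E[b]] is spanned by [n] powers of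
    [b]. *)
Lemma deg_is_card (I : finType) b n (x : I -> U) : deg_is K b n ->
  (forall i, x i \in simple_ext E b) ->
  (forall c : I -> U, (forall i, c i \in E) -> \sum_i c i * x i = 0 ->
     forall i, c i = 0) ->
  (#|I| <= n)%N.
Proof.
move=> [[g [gE g0 gb] <-] _] xb indep; rewrite leqNgt; apply/negP => nI.
have [c [cE [i ci] c0]] := simple_ext_root_bound (E := E) gE g0 gb xb nI.
by rewrite (indep c cE c0) eqxx in ci.
Qed.

Lemma deg_is_algebraic b n : deg_is K b n -> b \in algebraic_over E.
Proof.
move=> [[g [gE g0 gb] _] _]; apply/algebraic_overP; exists g; split=> //.
Qed.

Lemma deg_is1 b : K b -> deg_is K b 1.
Proof.
move=> Kb; have [|||n bn n1] := @deg_is_le b ('X - b%:P).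
- rewrite rpredB ?polyOverX // polyOverC; exact/mem_subfield_pred.
- exact: monic_neq0 (monicXsubC b).
- by rewrite root_XsubC.
have := deg_is_gt0 bn; move: n1; rewrite size_XsubC.
by case: n bn => [|[|]].
Qed.

Lemma deg_is1_mem b : deg_is K b 1 -> K b.
Proof.
move=> [[g [gE g0 /rootP gb] sg] _]; apply/mem_subfield_pred.
have {}sg : size g = 2%N by case: (size g) sg => [|[|[]]].
have g1 : g`_1 != 0 by rewrite -[1%N]/(2.-1)%N -sg lead_coef_eq0.
move: gb; rewrite horner_coef sg !big_ord_recl big_ord0 addr0 expr0 mulr1 /= expr1.
move=> /eqP; rewrite addrC addr_eq0 => /eqP gb.
have {}gE i : g`_i \in subfield_pred hK.
  by apply/(polyOverP (S := subfield_pred hK)).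
rewrite -(mulKf g1 b) gb.
by rewrite mulrC rpred_div ?rpredN ?gE.
Qed.

End Degree.

(** * Artin-Schreier polynomials *)

Section ArtinSchreier.
Variables (U : fieldType) (p : nat) (charp : p \in [pchar U]).
Variables (E : divringClosed U) (th : U).
Hypotheses (thE : th \notin E) (asE : th ^+ p - th \in E).
Implicit Types f g : {poly U}.

Let p_pr : prime p. Proof. exact: pcharf_prime charp. Qed.
Let p_gt0 : (0 < p)%N. Proof. exact: prime_gt0. Qed.

Definition as_poly : {poly U} := 'X^p - 'X - (th ^+ p - th)%:P.

Lemma size_as_poly : size as_poly = p.+1.
Proof.
rewrite /as_poly -addrA size_polyDl ?size_polyXn //.
rewrite ltnS -opprD size_polyN (leq_trans (size_polyD _ _)) // geq_max.
by rewrite size_polyX size_polyC prime_gt1 //= (leq_trans (leq_b1 _)).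
Qed.

Lemma as_poly_monic : as_poly \is monic.
Proof.
rewrite monicE lead_coefE size_as_poly /as_poly !coefB coefXn coefX coefC eqxx /=.
by rewrite (gtn_eqF (prime_gt1 p_pr)) (gtn_eqF p_gt0) !subr0.
Qed.

Lemma as_polyOver : as_poly \is a polyOver E.
Proof. by rewrite !rpredB ?polyOverX ?polyOverC ?rpredX ?polyOverX. Qed.

Lemma root_as_poly n : root as_poly (th + n%:R).
Proof.
apply/rootP; rewrite !hornerE; apply/eqP; rewrite subr_eq0; apply/eqP.
rewrite -!(pFrobenius_autE charp) rmorphD rmorph_nat /=.
by rewrite opprD addrACA subrr addr0.
Qed.

Lemma root_as_poly0 : root as_poly th.
Proof. by have := root_as_poly 0; rewrite addr0. Qed.

Let rs := [seq th + i%:R | i <- iota 0 p].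

Lemma natr_inj_lt_pchar i j : (i < p)%N -> (j < p)%N -> i%:R = j%:R :> U -> i = j.
Proof.
wlog ij : i j / (i <= j)%N => [H ip jp e|ip jp /eqP].
  by case/orP: (leq_total i j) => ?; [|apply/esym]; apply: H.
rewrite eq_sym -subr_eq0 -natrB // -(dvdn_pcharf charp) => /dvdnP[[|q]].
  by rewrite mul0n => /eqP; rewrite subn_eq0 => ji; apply/eqP; rewrite eqn_leq ij.
move=> e; have : (j - i < p)%N by apply: leq_ltn_trans jp; apply: leq_subr.
by rewrite e mulSn ltnNge leq_addr.
Qed.

Lemma as_polyE : as_poly = \prod_(z <- rs) ('X - z%:P).
Proof.
rewrite (@all_roots_prod_XsubC _ as_poly rs) ?(monicP as_poly_monic) ?scale1r //.
- by rewrite size_as_poly size_map size_iota.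
- by apply/allP => z /mapP[i _ ->]; exact: root_as_poly.
- rewrite uniq_rootsE map_inj_in_uniq ?iota_uniq // => i j.
  by rewrite !mem_iota /= => ip jp /addrI; apply: natr_inj_lt_pchar.
Qed.

(** The gcd of [g] and [as_poly] has coefficients in [E] and its roots form a list [s] of elements
    [th + i], with [0 < size s < p]. Their sum lies in [E] and is [size s] times [th] up to an
    integer; as [size s] is invertible, [th] would lie in [E]. *)
Lemma as_indep g : g \is a polyOver E -> (size g <= p)%N -> g.[th] = 0 -> g = 0.
Proof.
move=> gE sg gth; apply/eqP/negPn/negP => g0.
have [g' g'E] := polyOver_lift gE; have [f' f'E] := polyOver_lift as_polyOver.
pose d := map_poly val (gcdp g' f').
have dE : d = gcdp g as_poly by rewrite /d gcdp_map -g'E -f'E.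
have : d %| as_poly by rewrite dE dvdp_gcdr.
rewrite as_polyE => /dvdp_prod_XsubC[m]; set s := mask m rs => dP.
pose P := \prod_(z <- s) ('X - z%:P).
have P1 : P \is monic by apply: monic_prod_XsubC.
have sP : size P = (size s).+1 by apply: size_prod_XsubC.
have PE : P \is a polyOver E.
  have := eqp_eq dP; rewrite -/P (monicP P1) scale1r => dP'.
  have d0 : lead_coef d != 0 by rewrite lead_coef_eq0 dE gcdp_eq0 (negPf g0).
  rewrite -(scalerK d0 P) -dP'; apply: polyOverZ; last exact: polyOver_map.
  by rewrite rpredV; apply/polyOverP/polyOver_map.
have n_lt : (size s < p)%N.
  rewrite -ltnS -sP -(eqp_size dP) dE; apply: leq_ltn_trans (_ : size g < _)%N => //.
  by apply: dvdp_leq; rewrite ?dvdp_gcdl.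
have n_gt : (0 < size s)%N.
  have : root d th by rewrite dE root_gcd root_as_poly0 /root gth eqxx.
  by rewrite (eqp_root dP) root_prod_XsubC; case: s {P P1 sP PE n_lt dP}.
have sE : \sum_(z <- s) z \in E.
  rewrite -[X in X \in _]opprK rpredN -coefPn_prod_XsubC ?gtn_eqF //.
  exact/polyOverP.
have : th *+ size s \in E.
  have -> : th *+ size s = \sum_(z <- s) z - \sum_(z <- s) (z - th).
    by rewrite sumrB big_const_seq count_predT iter_addr_0 opprB addrC subrK.
  rewrite rpredB // big_seq; apply: rpred_sum => z /mem_mask /mapP[i _ ->].
  by rewrite addrC addKr rpred_nat.
have n0 : (size s)%:R != 0 :> U.
  rewrite -(dvdn_pcharf charp); apply/negP => /(dvdn_leq n_gt).
  by rewrite leqNgt n_lt.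
rewrite -mulr_natr => h; move/negP: thE; apply.
by rewrite -(mulfK n0 th) rpred_div ?rpred_nat.
Qed.

(** Modulo [as_poly], which also vanishes at [th + 1], [g] reduces to a polynomial covered by
    [as_indep]. *)
Lemma as_conj g : g \is a polyOver E -> g.[th] = 0 -> g.[th + 1] = 0.
Proof.
move=> gE.
have [q [r [_ rE -> rg]]] := polyOver_modr gE as_polyOver (monic_neq0 as_poly_monic).
have /rootP f0 := root_as_poly0.
have e x : (q * as_poly + r).[x] = q.[x] * as_poly.[x] + r.[x].
  by rewrite hornerD hornerM.
rewrite !e f0 mulr0 add0r => h; rewrite (as_indep rE _ h).
  by have /rootP -> := root_as_poly 1; rewrite mulr0 horner0 addr0.
by rewrite -ltnS -size_as_poly.
Qed.

Lemma as_algebraic : th \in algebraic_over E.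
Proof.
apply/algebraic_overP; exists as_poly; split; first exact: as_polyOver.
  exact: monic_neq0 as_poly_monic.
exact: root_as_poly0.
Qed.

Lemma as_repr x : x \in simple_ext E th ->
  exists g, [/\ g \is a polyOver E, (size g <= p)%N & x = g.[th]].
Proof.
move=> /(simple_ext_reduce as_polyOver (monic_neq0 as_poly_monic) root_as_poly0)[g []].
by rewrite size_as_poly; exists g.
Qed.

End ArtinSchreier.

(** * Values of formal series *)

Section ValuationBounds.
Variable k : fieldType.
Implicit Types (s t : hahn k) (a b c d q : rat).

(** Bounds on the support, rather than on [hval], hold for the zero series without a case
    distinction. *)
Definition val_ge s c := forall q, s q != 0 -> c <= q.
Definition val_gt s c := forall q, s q != 0 -> c < q.

Lemma val_ge0 c : val_ge 0 c.
Proof. by move=> q; rewrite hcoef0 eqxx. Qed.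

Lemma val_gt0 c : val_gt 0 c.
Proof. by move=> q; rewrite hcoef0 eqxx. Qed.

Lemma val_geD s t c : val_ge s c -> val_ge t c -> val_ge (s + t) c.
Proof.
move=> sc tc q; rewrite hcoefD; have [->|/sc //] := eqVneq (s q) 0.
by rewrite add0r; apply: tc.
Qed.

Lemma val_gtD s t c : val_gt s c -> val_gt t c -> val_gt (s + t) c.
Proof.
move=> sc tc q; rewrite hcoefD; have [->|/sc //] := eqVneq (s q) 0.
by rewrite add0r; apply: tc.
Qed.

Lemma val_geN s c : val_ge s c -> val_ge (- s) c.
Proof. by move=> sc q; rewrite hcoefN oppr_eq0; apply: sc. Qed.

Lemma val_gtN s c : val_gt s c -> val_gt (- s) c.
Proof. by move=> sc q; rewrite hcoefN oppr_eq0; apply: sc. Qed.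

Lemma val_geB s t c : val_ge s c -> val_ge t c -> val_ge (s - t) c.
Proof. by move=> sc tc; apply: val_geD => //; apply: val_geN. Qed.

Lemma val_gtB s t c : val_gt s c -> val_gt t c -> val_gt (s - t) c.
Proof. by move=> sc tc; apply: val_gtD => //; apply: val_gtN. Qed.

Lemma val_ge_trans s c d : d <= c -> val_ge s c -> val_ge s d.
Proof. by move=> dc sc q /sc; apply: le_trans. Qed.

Lemma val_gtW s c : val_gt s c -> val_ge s c.
Proof. by move=> sc q /sc/ltW. Qed.

Lemma val_ge_gt s c d : d < c -> val_ge s c -> val_gt s d.
Proof. by move=> dc sc q /sc; apply: lt_le_trans. Qed.

Lemma val_gtP s c : val_gt s c <-> val_ge s c /\ s c = 0.
Proof.
split=> [sc|[sc s0] q sq].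
  by split; [apply: val_gtW | apply/eqP/negPn/negP => /sc; rewrite ltxx].
rewrite lt_neqAle sc // andbT; apply: contraTneq isT => cq.
by rewrite -cq s0 eqxx in sq.
Qed.

Lemma val_geM s t c d : val_ge s c -> val_ge t d -> val_ge (s * t) (c + d).
Proof.
move=> sc td q /hcoefM_neq0[a /sc ca /td]; rewrite lerBrDl.
by apply: le_trans; rewrite lerD2r.
Qed.

Lemma val_gtM s t c d : val_gt s c -> val_ge t d -> val_gt (s * t) (c + d).
Proof.
move=> sc td q /hcoefM_neq0[a /sc ca /td]; rewrite lerBrDl.
by apply: lt_le_trans; rewrite ltrD2r.
Qed.

Lemma val_ge_monom q (x : k) : val_ge (hmonom q x) q.
Proof. by move=> a /=; case: (a =P q) => [->|]; rewrite ?eqxx. Qed.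

Lemma ypow_neq0 q : ypow k q != 0.
Proof.
by apply/eqP => /(congr1 (fun s : hahn k => s q)) /eqP; rewrite /= eqxx oner_eq0.
Qed.

Lemma val_ge1 : val_ge 1 0.
Proof. by move=> q; rewrite hcoef1; case: (q =P 0) => [->|]; rewrite ?eqxx. Qed.

Lemma val_geMn s c n : val_ge s c -> val_ge (s *+ n) c.
Proof.
by move=> sc; elim: n => [|n IH]; [exact: val_ge0 | rewrite mulrS; apply: val_geD].
Qed.

Lemma val_ge_nat n : val_ge n%:R 0.
Proof. exact/val_geMn/val_ge1. Qed.

Lemma val_geX s c n : val_ge s c -> val_ge (s ^+ n) (n%:R * c).
Proof. by move=> sc q; apply: hcoefX_ge. Qed.

Lemma val_exists s : s != 0 -> exists m, s m != 0 /\ val_ge s m.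
Proof.
move=> s0; have [|m [sm lm]] := hsupp_wo s _ (fun _ => id); last by exists m.
apply: contra_notP (negP s0) => h; apply/eqP/hahnP => q; apply/eqP/negPn/negP => sq.
by apply: h; exists q.
Qed.

Lemma hcoefM_val s t a b : val_ge s a -> val_ge t b ->
  (s * t) (a + b) = s a * t b.
Proof.
move=> sa tb.
rewrite [LHS](@hmul_coefE _ _ _ _ [:: a]) //; first by rewrite big_seq1 addrC addKr.
move=> c /sa ac /tb; rewrite lerBrDr addrC lerD2r => ca.
by rewrite inE eq_le ca ac.
Qed.

Lemma hcoefX_val s a n : val_ge s a -> (s ^+ n) (n%:R * a) = s a ^+ n.
Proof.
move=> sa; elim: n => [|n IH]; first by rewrite mul0r !expr0 hcoef1 eqxx.
by rewrite !exprS mulrS mulrDl mul1r hcoefM_val ?IH //; apply: val_geX.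
Qed.

Lemma hcoef0_nat n : (n%:R : hahn k) 0 = n%:R.
Proof. by rewrite hcoefMn hcoef1 eqxx. Qed.

Lemma val_inv s m : s m != 0 -> val_ge s m ->
  val_ge s^-1 (- m) /\ s^-1 (- m) = (s m)^-1.
Proof.
move=> sm lm; have s0 : s != 0.
  by apply: contraNneq sm => ->; rewrite hcoef0.
have [n [sn ln]] := val_exists (invr_neq0 s0).
have := hcoefM_val lm ln; rewrite divff // hcoef1 => e.
have mn : m + n = 0.
  apply/eqP/negPn/negP => mn; move/esym/eqP: e.
  by rewrite (negPf mn) mulf_eq0 (negPf sm) (negPf sn).
have nE : n = - m by apply/eqP; rewrite -addr_eq0 addrC mn.
split; first by rewrite -nE.
by apply: (mulfI sm); rewrite -nE -e mn eqxx divff.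
Qed.

Lemma val_ge_mulKl s m t c : s m != 0 -> val_ge s m ->
  val_ge (s * t) (m + c) -> val_ge t c.
Proof.
move=> sm lm st; have s0 : s != 0.
  by apply: contraNneq sm => ->; rewrite hcoef0.
by rewrite -(mulKf s0 t) -(addKr m c); apply: val_geM => //; apply: (val_inv sm lm).1.
Qed.

Lemma val_gt_dense s c : (forall d, d < c -> val_gt s d) -> val_ge s c.
Proof.
move=> h q sq; rewrite leNgt; apply/negP => qc.
by have := h q qc q sq; rewrite ltxx.
Qed.

Lemma val_ge_dense s c : (forall e, 0 < e -> val_ge s (c - e)) -> val_ge s c.
Proof.
move=> h q sq; rewrite leNgt; apply/negP => qc.
have := h ((c - q) / 2) _ q sq; rewrite divr_gt0 ?subr_gt0 // => /(_ isT).
rewrite lerBlDr -lerBlDl => h'.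
have : 0 < (c - q) / 2 by rewrite divr_gt0 ?subr_gt0.
have e : c - q = (c - q) / 2 + (c - q) / 2 by exact: splitr.
by rewrite {1}e in h'; rewrite ltNge; move: h'; rewrite gerDl => ->.
Qed.

Lemma hvalP s : s != 0 -> exists m, [/\ s m != 0, val_ge s m & hval s = m%:E%E].
Proof.
move=> /val_exists[m [sm lm]]; exists m; split=> //.
by apply: hvalE; split.
Qed.

Lemma val_geE s c : val_ge s c <-> (c%:E <= hval s)%E.
Proof.
have [->|/hvalP[m [sm lm ->]]] := eqVneq s 0.
  by rewrite hval0 leey; split=> // _; exact: val_ge0.
by rewrite lee_fin; split=> [/(_ m sm)//|cm]; apply: val_ge_trans lm.
Qed.

Lemma coef_residue_poly (f : {poly hahn k}) i : (residue_poly f)`_i = f`_i 0.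
Proof. by rewrite /residue_poly coef_map_id0. Qed.

(** On series of nonnegative value, taking the coefficient at [0] is a ring morphism: reduction to
    the residue field. *)
Lemma horner_residue (f : {poly hahn k}) z :
  (forall i, val_ge f`_i 0) -> val_ge z 0 ->
  f.[z] 0 = (residue_poly f).[z 0].
Proof.
move=> f0 z0; rewrite horner_coef hcoef_sum.
rewrite (@horner_coef_wide _ (size f)) ?size_poly //.
apply: eq_bigr => i _; have zi : val_ge (z ^+ i) 0.
  by have := val_geX (n := i) z0; rewrite mulr0.
have := hcoefM_val (f0 i) zi; rewrite addr0 coef_residue_poly => ->.
by congr (_ * _); have := hcoefX_val i z0; rewrite mulr0.
Qed.

Lemma polyOver_reverse (S : addrClosed (hahn k)) (f : {poly hahn k}) n :
  f \is a polyOver S -> \poly_(i < n.+1) f`_(n - i) \is a polyOver S.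
Proof.
move=> /polyOverP fS; apply/polyOverP => i; rewrite coef_poly.
by case: ifP => _; rewrite ?rpred0.
Qed.

Lemma horner_reverse (f : {poly hahn k}) n z : (size f <= n.+1)%N -> z != 0 ->
  f.[z] = z ^+ n * (\poly_(i < n.+1) f`_(n - i)).[z^-1].
Proof.
move=> fn z0; rewrite (horner_coef_wide _ fn) horner_poly mulr_sumr.
rewrite (reindex_inj rev_ord_inj) /=; apply: eq_bigr => i _.
have i_le : (i <= n)%N by rewrite -ltnS.
by rewrite mulrCA subSS exprVn -expfB_cond ?(negPf z0).
Qed.

(** If [z] had negative value, [z^-1] would have residue [0] and be a root of the reversed
    polynomial, whose constant coefficient is [1]. *)
Lemma integral_val_ge (f : {poly hahn k}) z : f \is monic ->
  (forall i, val_ge f`_i 0) -> root f z -> val_ge z 0.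
Proof.
move=> f1 f0 /rootP fz; apply: contrapT => nz.
have z0 : z != 0 by apply: contra_notN nz => /eqP ->; exact: val_ge0.
have [m [zm lm]] := val_exists z0.
have m_lt0 : m < 0.
  by rewrite ltNge; apply/negP => m0; apply: nz; apply: val_ge_trans lm.
have [vl ve] := val_inv zm lm.
have zi0 : val_gt z^-1 0 by apply: val_ge_gt vl; rewrite oppr_gt0.
have sf : (0 < size f)%N by rewrite size_poly_gt0 monic_neq0.
have := @horner_reverse f (size f).-1 z; rewrite prednK // => /(_ (leqnn _) z0).
set r := \poly_(i < _) _; rewrite fz => /esym/eqP.
rewrite mulf_eq0 expf_eq0 (negPf z0) andbF => /eqP rz.
have r0 i : val_ge r`_i 0.
  by rewrite coef_poly; case: ifP => _ //; exact: val_ge0.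
have := horner_residue r0 (val_gtW zi0); rewrite rz.
have /val_gtP[_ ->] := zi0; rewrite horner_coef0 coef_residue_poly coef_poly.
rewrite sf subn0 -lead_coefE (monicP f1) hcoef1 eqxx => /eqP.
by rewrite hcoef0 eq_sym oner_eq0.
Qed.

Definition hahn_int : {pred hahn k} := [pred s | `[< val_ge s 0 >]].

Lemma hahn_intP s : reflect (val_ge s 0) (s \in hahn_int).
Proof. exact: asboolP. Qed.

Fact hahn_int_subring : subring_closed hahn_int.
Proof.
split=> [|s t /hahn_intP hs /hahn_intP ht|s t /hahn_intP hs /hahn_intP ht];
  apply/hahn_intP.
- exact: val_ge1.
- exact: val_geB.
- by have := val_geM hs ht; rewrite addr0.
Qed.

HB.instance Definition _ :=
  GRing.isSubringClosed.Build (hahn k) hahn_int hahn_int_subring.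

End ValuationBounds.

(** * Conjugates over a Henselian field *)

Section Conjugates.
Variables (k : closedFieldType) (K : set (hahn k)) (hK : is_subfield K).
Hypotheses (kyK : rat_subfield k `<=` K) (hensK : henselian K).

Local Notation E := (subfield_pred hK : divringClosed (hahn k)).

Lemma hconst_mem c : hconst c \in E.
Proof.
by apply/mem_subfield_pred; apply: kyK; apply: sub_gen_smallest; left; exists c.
Qed.

Lemma ypow_int_mem (z : int) : ypow k z%:~R \in E.
Proof.
have y1 : ypow k 1 \in E.
  by apply/mem_subfield_pred; apply: kyK; apply: sub_gen_smallest; right.
have yn n : ypow k n%:R \in E.
  suff -> : ypow k n%:R = ypow k 1 ^+ n by apply: rpredX.
  by rewrite hmonomX mulr1 expr1n.
case: z => n; first exact: yn.
rewrite NegzE mulrNz; suff -> : ypow k (- n.+1%:~R) = (ypow k n.+1%:R)^-1.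
  by rewrite rpredV.
have e : ypow k (- n.+1%:~R) * ypow k n.+1%:R = 1.
  by rewrite hmonomM mulr1 addNr.
by apply: (mulIf (ypow_neq0 k n.+1%:R)); rewrite e mulVf ?ypow_neq0.
Qed.

(** For algebraic [x] this one-sided condition already says that [x] and [x'] share their minimal
    polynomial over [K]. *)
Definition conjugate_over (x x' : hahn k) :=
  forall f, f \is a polyOver E -> f.[x] = 0 -> f.[x'] = 0.

Lemma conjugate_horner g x x' : g \is a polyOver E ->
  conjugate_over x x' -> conjugate_over g.[x] g.[x'].
Proof.
move=> gE xx f fE; rewrite -!horner_comp; apply: xx.
exact: polyOver_comp.
Qed.

(** Divide by a coefficient of least value. *)
Lemma primitive_multiple (f : {poly hahn k}) : f \is a polyOver E -> f != 0 ->
  exists c, [/\ c \in E, c != 0, forall i, val_ge (c *: f)`_i 0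
              & residue_poly (c *: f) != 0].
Proof.
move=> /polyOverP fE f0.
have sf : (0 < size f)%N by rewrite size_poly_gt0.
have /choice[w wP] : forall i : 'I_(size f), exists m : rat,
    f`_i != 0 -> f`_i m != 0 /\ val_ge f`_i m.
  move=> i; have [->|/val_exists[m hm]] := eqVneq f`_i 0; first by exists 0.
  by exists m.
have pf : ((size f).-1 < size f)%N by rewrite ltn_predL.
have : f`_(Ordinal pf) != 0 by rewrite -lead_coefE lead_coef_eq0.
move=> i0.
case: (@arg_minP _ _ _ (Ordinal pf) (fun i : 'I_(size f) => f`_i != 0) w i0).
move=> j fj wj; have [jw jl] := wP j fj; have [vl ve] := val_inv jw jl.
exists (f`_j)^-1; rewrite rpredV fE invr_eq0; split=> //.
  move=> i; rewrite coefZ; have [i_lt|i_ge] := ltnP i (size f); last first.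
    by rewrite (nth_default _ i_ge) mulr0; exact: val_ge0.
  have [->|fi] := eqVneq f`_i 0; first by rewrite mulr0; exact: val_ge0.
  have [iw il] := wP (Ordinal i_lt) fi.
  have := val_geM vl il; apply: val_ge_trans.
  by rewrite addrC subr_ge0; apply: wj.
apply: contraTneq isT => /(congr1 (fun g : {poly k} => g`_j)).
rewrite coef_residue_poly coefZ mulVf // coef0 hcoef1 eqxx => /eqP.
by rewrite oner_eq0.
Qed.

Lemma hensel_factor (f : {poly hahn k}) (g0 h0 : {poly k}) :
    f \is monic -> f \is a polyOver E -> f \is a polyOver (@hahn_int k) ->
    g0 \is monic -> h0 \is monic -> coprimep g0 h0 ->
    residue_poly f = g0 * h0 ->
  exists g h : {poly hahn k},
    [/\ g \is monic, g \is a polyOver E & g \is a polyOver (@hahn_int k)] /\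
    [/\ h \is a polyOver (@hahn_int k), f = g * h,
        residue_poly g = g0 & residue_poly h = h0].
Proof.
have valP (q : {poly hahn k}) : q \is a polyOver [in val_ring K] <->
    q \is a polyOver E /\ q \is a polyOver (@hahn_int k).
  split=> [/allP h|[/allP h1 /allP h2]].
    have {}h a : a \in (q : seq _) -> val_ring K a.
      by move=> /h ha; apply: set_mem; exact: ha.
    split; apply/allP => a /h[Ka va]; first exact/mem_subfield_pred.
    exact/hahn_intP/val_geE.
  apply/allP => a ha; change (a \in val_ring K); apply: mem_set; split.
    exact/mem_subfield_pred/h1.
  exact/val_geE/hahn_intP/h2.
move=> f1 fE fO g01 h01 cop res.
have [|g [h [[g1 /valP[gE gO] h1 /valP[hE hO]] [fgh rg rh]]]] :=
  hensK f1 _ g01 h01 cop res; first exact/valP.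
by exists g, h.
Qed.

(* A Moebius substitution z = 1/(x - t) with t in k generic makes a polynomial
   killing x monic and integral; Hensel's lemma then isolates the factor whose
   residue is a power of X + 1/t, and both x and x' are killed by it. *)
Lemma conjugate_val_gt0 x x' : x \in algebraic_over E -> conjugate_over x x' ->
  val_gt x 0 -> val_gt x' 0.
Proof.
move=> /algebraic_overP[F0 [F0E F00 /rootP F0x]] xx x_gt0.
have [c [cE c0 FO Fr]] := primitive_multiple F0E F00.
set F := c *: F0 in FO Fr.
have FE : F \is a polyOver E by apply: polyOverZ.
have Fx : F.[x] = 0 by rewrite hornerZ F0x mulr0.
have F_neq0 : F != 0 by rewrite scaler_eq0 negb_or c0.
clearbody F.
(* Some [t] in [k] avoids [0] and the roots of the residue polynomial; then [F.[T]] is a unit of the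
   valuation ring. *)
have [t] : exists t, ~~ root ('X * residue_poly F) t.
  by apply/closed_nonrootP; rewrite mulf_eq0 polyX_eq0.
rewrite rootM rootX negb_or => /andP[t0 Ft].
pose T := hconst t.
have TO : val_ge T 0 by apply: val_ge_monom.
have T0 : T 0 = t by [].
have XT : 'X + T%:P \is a polyOver E.
  by rewrite rpredD ?polyOverX ?polyOverC ?hconst_mem.
pose F1 := F \Po ('X + T%:P).
have F1E : F1 \is a polyOver E by apply: polyOver_comp.
have F1O : F1 \is a polyOver (@hahn_int k).
  apply: polyOver_comp; first by apply/polyOverP => i; apply/hahn_intP.
  by rewrite rpredD ?polyOverX ?polyOverC //; apply/hahn_intP.
have F10 : F1`_0 = F.[T].
  by rewrite -horner_coef0 horner_comp !hornerE.
have F10r : (F1`_0) 0 = (residue_poly F).[t] by rewrite F10 horner_residue ?T0.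
have F10_O : val_ge F1`_0 0 by apply/hahn_intP; apply/polyOverP.
have F10_neq0 : (F1`_0) 0 != 0 by rewrite F10r.
have F1_0 : F1`_0 != 0.
  by apply: contraNneq F10_neq0 => ->; rewrite hcoef0.
have [F10V _] := val_inv F10_neq0 F10_O; rewrite oppr0 in F10V.
have sF1 : size F1 = size F by rewrite size_comp_poly2 // size_XaddC.
pose n := (size F1).-1.
have sF1n : size F1 = n.+1 by rewrite prednK // sF1 size_poly_gt0.
(* [G] is the reversal of [F(X + T)], scaled to be monic; it stays integral because the constant
   coefficient [F.[T]] of [F1] is a unit. *)
pose G0 := \poly_(i < n.+1) F1`_(n - i).
pose G := (F1`_0)^-1 *: G0.
have lG0 : lead_coef G0 = F1`_0 by rewrite lead_coef_poly ?subnn.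
have G1 : G \is monic by rewrite monicE lead_coefZ lG0 mulVf.
have GE : G \is a polyOver E.
  apply: polyOverZ; first by rewrite rpredV; apply/polyOverP.
  exact: polyOver_reverse.
have GO : G \is a polyOver (@hahn_int k).
  apply: polyOverZ; first exact/hahn_intP.
  exact: polyOver_reverse.
have [xO x0] := (val_gtP x 0).1 x_gt0.
have xT0 : (x - T) 0 = - t by rewrite hcoefB x0 T0 sub0r.
have xTO : val_ge (x - T) 0 by apply: val_geB.
have [|zO zr] := val_inv (s := x - T) (m := 0) _ xTO; first by rewrite xT0 oppr_eq0.
rewrite oppr0 xT0 in zO zr; set z := (x - T)^-1 in zO zr.
have xT_neq0 : x - T != 0.
  by apply: contraNneq t0 => e; rewrite -oppr_eq0 -xT0 e hcoef0.
have Gz : G.[z] = 0.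
  rewrite hornerZ; apply/eqP; rewrite mulf_eq0 invr_eq0 (negPf F1_0) /=.
  have /eqP := @horner_reverse _ F1 n _ (eq_leq sF1n) xT_neq0.
  rewrite horner_comp !hornerE subrK Fx eq_sym mulf_eq0 expf_eq0 (negPf xT_neq0).
  by rewrite andbF.
pose u := (- t)^-1.
have [s [h0 h0u resE]] := multiplicity_XsubC (residue_poly G) u.
have rG0 : residue_poly G != 0.
  apply: contraTneq isT => /(congr1 (fun g : {poly k} => g`_(size G).-1)).
  rewrite coef_residue_poly -lead_coefE (monicP G1) coef0 hcoef1 eqxx => /eqP.
  by rewrite oner_eq0.
rewrite rG0 /= in h0u.
have g01 : ('X - u%:P) ^+ s \is monic by rewrite monic_exp // monicXsubC.
have h01 : h0 \is monic.
  rewrite -(monicMr _ g01) -resE monicE lead_coefE.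
  have <- : size G = size (residue_poly G).
    apply/esym/size_poly_eq.
    by rewrite -lead_coefE (monicP G1) hcoef1 eqxx oner_eq0.
  by rewrite coef_residue_poly -lead_coefE (monicP G1) hcoef1 eqxx.
have cop : coprimep (('X - u%:P) ^+ s) h0.
  by rewrite coprimep_expl // coprimep_sym coprimep_XsubC.
have [|g [h [[g1 gE gO] [hO Ggh rg rh]]]] := hensel_factor G1 GE GO g01 h01 cop.
  by rewrite resE mulrC.
have coefO (q : {poly hahn k}) :
    q \is a polyOver (@hahn_int k) -> forall i, val_ge q`_i 0.
  by move=> /polyOverP qO i; apply/hahn_intP.
(* The residue [u] of [z] is not a root of [h0], so [h] does not vanish at [z] and [g] must. *)
have gz : g.[z] = 0.
  move/eqP: Gz; rewrite Ggh hornerM mulf_eq0 => /orP[/eqP //|/eqP hz].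
  have := horner_residue (coefO _ hO) zO; rewrite hz hcoef0 rh zr => /esym/rootP.
  by rewrite (negPf h0u).
pose m := (size g).-1.
have gm : size g = m.+1 by rewrite prednK // size_poly_gt0 monic_neq0.
pose q := \poly_(i < m.+1) g`_(m - i).
have qE : q \is a polyOver E.
  exact: polyOver_reverse.
have XT' : 'X - T%:P \is a polyOver E.
  by rewrite rpredB ?polyOverX ?polyOverC ?hconst_mem.
(* Undoing the substitution turns [g] into a polynomial over [K] killing [x], hence [x']; so
   [1 / (x' - T)] is a root of [g] and also has residue [u]. *)
have := xx (q \Po ('X - T%:P)) (polyOver_comp qE XT').
rewrite !horner_comp !hornerE.
have := @horner_reverse _ g m _ (eq_leq gm) (invr_neq0 xT_neq0).
rewrite gz invrK => /esym/eqP; rewrite mulf_eq0 expf_eq0 invr_eq0 (negPf xT_neq0) andbF.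
move=> /eqP -> /(_ erefl); set d := x' - T => qd.
have d0 : d != 0.
  apply: contraTneq isT => d0; move: qd; rewrite d0 horner_coef0 coef_poly /= subn0.
  by rewrite -lead_coefE (monicP g1) => /eqP; rewrite oner_eq0.
have gd : g.[d^-1] = 0.
  by rewrite (horner_reverse (eq_leq gm) (invr_neq0 d0)) invrK qd mulr0.
have dO : val_ge d^-1 0.
  by apply: (integral_val_ge g1 (coefO _ gO)); apply/rootP.
have dr : d^-1 0 = u.
  have := horner_residue (coefO _ gO) dO; rewrite gd hcoef0 rg => /esym/rootP.
  by rewrite /root horner_exp !hornerE expf_eq0 subr_eq0 => /andP[_ /eqP].
have u0 : u != 0 by rewrite invr_eq0 oppr_eq0.
have [] := val_inv (s := d^-1) (m := 0) _ dO; first by rewrite dr.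
rewrite oppr0 invrK dr invrK => dO' d0'.
have -> : x' = d + T by rewrite subrK.
apply/val_gtP; split; first exact: val_geD.
by rewrite hcoefD d0' T0 addNr.
Qed.

(** Reduction to [c = 0]: with [N] the denominator of [c], the exponent [N c] is an integer, so the
    monomial normalizing [x^N] lies in [K]. *)
Lemma conjugate_val_gt x x' c : x \in algebraic_over E -> conjugate_over x x' ->
  val_gt x c -> val_gt x' c.
Proof.
move=> ax xx x_gt; pose N := `|denq c|%N.
have N0 : (0 < N)%N by rewrite absz_gt0 denq_neq0.
have Nc : N%:R * c = (numq c)%:~R.
  rewrite -[N%:R]/(N%:~R) (_ : (N : int) = denq c); last first.
    by rewrite /N -[LHS]/(`|denq c|%:Z) gez0_abs // ltW ?denq_gt0.
  by rewrite mulrC -[c in c * _]divq_num_den divfK // intr_eq0 denq_neq0.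
pose y := ypow k (- (numq c)%:~R).
have yE : y \in E by rewrite /y -mulrNz ypow_int_mem.
pose g := y *: 'X^N.
have gE : g \is a polyOver E by rewrite polyOverZ ?rpredX ?polyOverX.
have gv s : g.[s] = y * s ^+ N by rewrite !hornerE.
have h : val_gt g.[x] 0.
  rewrite gv -[N]prednK // => q; rewrite hcoef_monomM mul1r => /(hcoefX_gt x_gt).
  by rewrite prednK // Nc opprK -subr_gt0 addrK.
have ag : g.[x] \in algebraic_over E.
  by apply: (simple_ext_algebraic ax); apply/simple_extP; exists g.
have := conjugate_val_gt0 ag (conjugate_horner gE xx) h.
rewrite gv => h'; have [->|/val_exists[m [x'm lm]]] := eqVneq x' 0.
  exact: val_gt0.
apply: (val_ge_gt _ lm); rewrite -(@ltr_pM2l _ N%:R) ?ltr0n // Nc -subr_gt0.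
apply: h'; rewrite hcoef_monomM mul1r opprK subrK.
by rewrite (hcoefX_val _ lm) expf_neq0.
Qed.

Lemma conjugate_val_ge x x' c : x \in algebraic_over E -> conjugate_over x x' ->
  val_ge x c -> val_ge x' c.
Proof.
move=> ax xx x_ge; apply: val_gt_dense => d dc.
by apply: (conjugate_val_gt ax xx); apply: val_ge_gt x_ge.
Qed.

End Conjugates.

(** * Approximation in Artin-Schreier extensions *)

Section Delta.
Variable R : fieldType.
Implicit Type f : {poly R}.

Definition delta f := f \Po ('X + 1%:P) - f.

Lemma deltaE f x : (delta f).[x] = f.[x + 1] - f.[x].
Proof. by rewrite !(hornerD, hornerN) horner_comp !hornerE. Qed.

Lemma size_delta f : f != 0 -> (size (delta f) < size f)%N.
Proof.
move=> f0; have sf : (0 < size f)%N by rewrite size_poly_gt0.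
rewrite -(ltn_predK sf) ltnS; apply/leq_sizeP => j; rewrite leq_eqVlt.
have sc : size (f \Po ('X + 1%:P)) = size f by rewrite size_comp_poly2 ?size_XaddC.
move=> /orP[/eqP <-|jf]; last first.
  have sj : (size f <= j)%N by rewrite -(ltn_predK sf).
  by rewrite coefB !nth_default ?subrr ?sc.
rewrite coefB -lead_coefE -[X in _`_(X.-1)]sc -lead_coefE.
by rewrite lead_coef_comp ?size_XaddC // lead_coefXaddC expr1n mulr1 subrr.
Qed.

Lemma polyOver_delta (S : subringClosed R) f :
  f \is a polyOver S -> delta f \is a polyOver S.
Proof.
move=> fS; rewrite rpredB // polyOver_comp //.
by rewrite rpredD ?polyOverX ?polyOverC ?rpred1.
Qed.

(** [f] is constant on the [p] elements of the prime field, which gives [f] minus its constant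
    coefficient too many roots. *)
Lemma delta_eq0 p f : p \in [pchar R] -> (size f <= p)%N -> delta f = 0 ->
  f = (f`_0)%:P.
Proof.
move=> charp fp df0; apply/eqP; rewrite -subr_eq0; apply/eqP.
have fi i : f.[i%:R] = f.[0].
  elim: i => [//|i <-]; have := deltaE f i%:R.
  by rewrite df0 horner0 natr1 => /esym/eqP; rewrite subr_eq0 => /eqP.
apply: (@roots_geq_poly_eq0 _ _ [seq i%:R | i <- iota 0 p]).
- by apply/allP => x /mapP[i _ ->]; rewrite /root !hornerE fi horner_coef0 subrr.
- rewrite map_inj_in_uniq ?iota_uniq // => i j.
  by rewrite !mem_iota /= => ip jp; apply: natr_inj_lt_pchar charp _ _ ip jp.
- rewrite size_map size_iota (leq_trans (size_polyD _ _)) // geq_max fp size_polyN.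
  rewrite (leq_trans (size_polyC_leq1 _)) //.
  by rewrite prime_gt0 // (pcharf_prime charp).
Qed.

End Delta.

(** * Interpolation bounds at integer points *)

Section Interpolation.
Variables (k : fieldType) (p : nat) (charp : p \in [pchar k]).

Lemma val_ge_inv_natB i n : (i < n < p)%N ->
  val_ge ((i%:R - n%:R : hahn k)^-1) 0.
Proof.
move=> /andP[i_n n_p].
have [||] := @val_inv k (i%:R - n%:R) 0; last by rewrite oppr0.
  rewrite hcoefB !hcoef0_nat subr_eq0; apply: (contraTneq _ i_n) => e.
  by rewrite (natr_inj_lt_pchar charp (ltn_trans i_n n_p) n_p e) ltnn.
by apply: val_geB; apply: val_ge_nat.
Qed.

(** Subtract [f(n)] and divide by [X - n]: the quotient has smaller size, and its values at the
    integers [i < n] keep the bound [c] because [i - n] is a unit. Each such division costs [e]. *)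
Lemma val_ge_interpolation (f : {poly hahn k}) n c e z : (n <= p)%N ->
  (size f <= n)%N -> (forall i, (i < n)%N -> val_ge f.[i%:R] c) ->
  0 <= e -> val_ge z (- e) -> val_ge f.[z] (c - n%:R * e).
Proof.
move=> np fn fi e0 ze; elim: n f np fn fi => [|n IH] f np fn fi.
  by move: fn; rewrite leqn0 size_poly_eq0 => /eqP ->; rewrite horner0; exact: val_ge0.
have /factor_theorem[q qE] : root (f - (f.[n%:R])%:P) n%:R.
  by rewrite /root !hornerE subrr.
have fE x : f.[x] = q.[x] * (x - n%:R) + f.[n%:R].
  have := congr1 (fun g => g.[x]) qE; rewrite !hornerE => h.
  by rewrite -h subrK.
have ce : c - n.+1%:R * e <= c by rewrite gerBl mulr_ge0.
rewrite fE; apply: val_geD; last exact: (val_ge_trans ce (fi n (ltnSn n))).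
have -> : c - n.+1%:R * e = (c - n%:R * e) + - e.
  by rewrite -natr1 mulrDl mul1r opprD addrA.
apply: val_geM; last first.
  by apply: val_geB => //; apply: val_ge_trans (@val_ge_nat k n); rewrite oppr_le0.
apply: IH; first exact: ltnW.
  have [->|q0] := eqVneq q 0; first by rewrite size_poly0.
  have : (size (q * ('X - n%:R%:P))%R <= n.+1)%N.
    rewrite -qE (leq_trans (size_polyD _ _)) // size_polyN geq_max fn.
    by rewrite (leq_trans (size_polyC_leq1 _)).
  by rewrite size_Mmonic ?monicXsubC // size_XsubC addn2.
move=> i i_n.
have i0 : i%:R - n%:R != 0 :> hahn k.
  rewrite subr_eq0; apply: (contraTneq _ i_n) => /(congr1 (fun s : hahn k => s 0)).
  rewrite !hcoef0_nat => /(natr_inj_lt_pchar charp (ltn_trans i_n np) np) ->.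
  by rewrite ltnn.
have -> : q.[i%:R] = (f.[i%:R] - f.[n%:R]) * (i%:R - n%:R)^-1.
  by rewrite fE addrK mulfK.
rewrite -[c]addr0; apply: val_geM; last by apply: val_ge_inv_natB; rewrite i_n.
by apply: val_geB; apply: fi; rewrite // ltnS ltnW.
Qed.

End Interpolation.

(** * Valuations in Artin-Schreier extensions of a field above [K] *)

Section ArtinSchreierValuation.
Variables (k : closedFieldType) (p : nat) (charp : p \in [pchar k]).
Variables (K : set (hahn k)) (hK : is_subfield K).
Hypotheses (kyK : rat_subfield k `<=` K) (hensK : henselian K).
Local Notation E0 := (subfield_pred hK : divringClosed (hahn k)).
Variables (E : divringClosed (hahn k)) (th : hahn k).
Hypotheses (E0E : forall x, x \in E0 -> x \in E).
Hypothesis aE : forall x, x \in E -> x \in algebraic_over E0.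
Hypotheses (thE : th \notin E) (asE : th ^+ p - th \in E).
Hypothesis ath : th \in algebraic_over E0.
Implicit Types (f g : {poly hahn k}) (c e : rat).

Let charH : p \in [pchar (hahn k)]. Proof. exact: pchar_hahn. Qed.
Let p_gt0 : (0 < p)%N. Proof. exact/prime_gt0/(pcharf_prime charp). Qed.

Let polyOver_E0E f : f \is a polyOver E0 -> f \is a polyOver E.
Proof. by move=> /polyOverP h; apply/polyOverP => i; apply: E0E. Qed.

Let horner_alg f : f \is a polyOver E -> f.[th] \in algebraic_over E0.
Proof.
move=> /polyOverP fE; rewrite horner_coef; apply: rpred_sum => i _.
by apply: rpredM; [apply: aE | apply: rpredX].
Qed.

(** The coefficients of [g] may lie in [E], as [th] and [th + 1] are conjugate over [E]; the
    conclusion is over [K], the field for which Hensel's lemma is assumed. *)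
Lemma as_conjugate g : g \is a polyOver E ->
  conjugate_over hK g.[th] g.[th + 1].
Proof.
move=> gE f /polyOver_E0E fE; rewrite -!horner_comp.
by apply: (as_conj charH thE asE); apply: polyOver_comp.
Qed.

Lemma as_val_gt g c : g \is a polyOver E -> val_gt g.[th] c -> val_gt g.[th + 1] c.
Proof.
move=> gE; apply: (conjugate_val_gt kyK hensK); [exact: horner_alg | exact: as_conjugate].
Qed.

Lemma as_val_ge g c : g \is a polyOver E -> val_ge g.[th] c -> val_ge g.[th + 1] c.
Proof.
move=> gE; apply: (conjugate_val_ge kyK hensK); [exact: horner_alg | exact: as_conjugate].
Qed.

Let shift_over n g : g \is a polyOver E -> g \Po ('X + n%:R%:P) \is a polyOver E.
Proof.
by move=> gE; rewrite polyOver_comp // rpredD ?polyOverX ?polyOverC ?rpred_nat.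
Qed.

Lemma as_val_ge_nat g n c : g \is a polyOver E -> val_ge g.[th] c ->
  val_ge g.[th + n%:R] c.
Proof.
move=> gE gc; elim: n => [|n IH]; first by rewrite addr0.
have := @as_val_ge (g \Po ('X + n%:R%:P)) c (shift_over n gE).
rewrite !horner_comp !hornerE => /(_ IH).
by rewrite -addrA [1 + _]addrC natr1.
Qed.

Lemma as_distance b : b \in E -> ~ val_ge (th - b) 0.
Proof.
(* Subtracting the residue of [th - b] gives [f(th)] positive value, hence also [f(th + 1)]; but
   they differ by [1]. *)
move=> bE thb; pose f := 'X - (b + hconst ((th - b) 0))%:P.
have fE : f \is a polyOver E.
  rewrite rpredB ?polyOverX // polyOverC rpredD //; apply: E0E.
  exact: hconst_mem.
have f_gt : val_gt f.[th] 0.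
  rewrite !hornerE opprD addrA; apply/val_gtP; split.
    by apply: val_geB => //; apply: val_ge_monom.
  by rewrite hcoefB subrr.
have := as_val_gt fE f_gt => /val_gtB /(_ f_gt).
have -> : f.[th + 1] - f.[th] = 1.
  by rewrite !hornerE opprB addrA subrK addrC addrA addNr add0r.
by move=> /(_ 0); rewrite hcoef1 eqxx oner_eq0 ltxx => /(_ isT).
Qed.

Hypothesis approx : forall e, 0 < e -> exists2 a, a \in E & val_ge (th - a) (- e).

(** The differences [g(th + i) - g(th)] are sums of conjugates of [delta g (th)], so they share its
    lower bound. Interpolating [g(th + z) - g(th)] at [z = a - th], with [a] in [E] close to [th],
    gives the witness [g(a)]. *)
Lemma as_approx g c : g \is a polyOver E -> (size g <= p)%N ->
  val_gt (delta g).[th] c -> exists2 r, r \in E & val_gt (g.[th] - r) c.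
Proof.
move=> gE gp dg_gt.
have [c' cc' dg_ge] : exists2 c', c < c' & val_ge (delta g).[th] c'.
  have [->|/val_exists[m [dm lm]]] := eqVneq (delta g).[th] 0.
    by exists (c + 1); [rewrite ltrDl | exact: val_ge0].
  by exists m => //; apply: dg_gt.
have gi i : val_ge (g.[th + i%:R] - g.[th]) c'.
  elim: i => [|i IH]; first by rewrite addr0 subrr; exact: val_ge0.
  have -> : g.[th + i.+1%:R] - g.[th] =
      (delta g).[th + i%:R] + (g.[th + i%:R] - g.[th]).
    by rewrite deltaE addrA subrK -natr1 addrA.
  by apply: val_geD => //; apply: as_val_ge_nat => //; apply: polyOver_delta.
(* With this choice the interpolation loss [p e] is half of the gap [c' - c]. *)
pose e := (c' - c) / 2 / p%:R.
have p0 : p%:R != 0 :> rat by rewrite pnatr_eq0 -lt0n.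
have e_gt0 : 0 < e by rewrite !divr_gt0 ?subr_gt0 ?ltr0n.
have [a aEE ath_ge] := approx e_gt0; exists g.[a].
  rewrite horner_coef; apply: rpred_sum => i _.
  by rewrite rpredM ?rpredX //; apply/polyOverP.
pose f := g \Po ('X + th%:P) - (g.[th])%:P.
have fE z : f.[z] = g.[th + z] - g.[th].
  by rewrite hornerD horner_comp !hornerE addrC [z + th]addrC addrC.
have : val_ge f.[a - th] (c' - p%:R * e).
  apply: (val_ge_interpolation charp) => //; last 2 first.
  - exact: ltW.
  - by rewrite -opprB; apply: val_geN.
  - have [g0|g0] := eqVneq g 0.
      by rewrite /f g0 comp_poly0 horner0 polyC0 subr0 size_poly0.
    rewrite (leq_trans (size_polyD _ _)) // geq_max size_polyN.
    rewrite size_comp_poly2 ?size_XaddC // gp.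
    by rewrite (leq_trans (size_polyC_leq1 _)).
  - by move=> i _; rewrite fE.
rewrite fE [th + _]addrC subrK => /val_geN; rewrite opprB.
apply: val_ge_gt.
have -> : c' - p%:R * e = c + (c' - c) / 2.
  rewrite /e mulrC divfK //; apply: (addIr ((c' - c) / 2)).
  by rewrite subrK -addrA -splitr addrC subrK.
by rewrite ltrDl divr_gt0 ?subr_gt0.
Qed.

(** This expresses that [E(th)] is an immediate extension of [E]. With [m] the value of [g(th)],
    [as_approx] applies when [delta g (th)] has value above [m]; the other case is contradictory. *)
Lemma as_immediate g : g \is a polyOver E -> (size g <= p)%N -> g != 0 ->
  exists r, [/\ r \in E, r != 0 & val_gt (g.[th] / r - 1) 0].
Proof.
have [n] := ubnP (size g); elim: n g => // n IH g; rewrite ltnS => gn gE gp g0.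
have x0 : g.[th] != 0.
  by apply: contraNneq g0 => gth; rewrite (as_indep charH thE asE gE gp gth).
have [m [xm lm]] := val_exists x0.
have [d_gt|d_ngt] := pselect (val_gt (delta g).[th] m).
  have [r rE /val_gtP[r_ge r_m]] := as_approx gE gp d_gt.
  have rm : r m = g.[th] m.
    by move/eqP: r_m; rewrite hcoefB subr_eq0 => /eqP.
  have rl : val_ge r m.
    by rewrite -[r](subKr g.[th]); apply: val_geB.
  have r0 : r != 0 by apply: contraNneq xm => r0; rewrite -rm r0 hcoef0.
  exists r; split=> //.
  have [|vl _] := val_inv _ rl; first by rewrite rm.
  rewrite -(mulfV r0) -mulrBl -(addrN m); apply: val_gtM => //.
  by apply/val_gtP; split.
(* Now [delta g (th)] has value exactly [m]; by induction it is some [r] in [E] up to a factor of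
   residue [1]. But [g(th) / r] minus its residue has positive value, and so has its conjugate,
   which forces [delta g (th) / r] to have positive value. *)
have d_ge : val_ge (delta g).[th] m.
  by rewrite deltaE; apply: val_geB => //; apply: as_val_ge.
have dm : (delta g).[th] m != 0.
  by apply: contra_notN d_ngt => /eqP dm; apply/val_gtP.
have dg0 : delta g != 0.
  by apply: contraNneq dm => ->; rewrite horner0 hcoef0.
have sd := size_delta g0.
have [r [rE r0 r_gt]] := IH _ (leq_trans sd gn) (polyOver_delta gE)
  (ltnW (leq_trans sd gp)) dg0.
set y := (delta g).[th] in d_ge dm r_gt.
have y0 : y != 0 by apply: contraNneq dm => ->; rewrite hcoef0.
have yr_ge : val_ge (y / r) 0.
  by rewrite -[y / r](subrK 1); apply: val_geD; [exact: val_gtW | exact: val_ge1].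
have xr_ge : val_ge (g.[th] / r) 0.
  have := val_geM lm (val_inv dm d_ge).1; rewrite addrN => /val_geM /(_ yr_ge).
  by rewrite addr0 mulrA divfK.
pose f := r^-1 *: g - (hconst ((g.[th] / r) 0))%:P.
have fE : f \is a polyOver E.
  rewrite rpredB ?polyOverZ ?rpredV // polyOverC; apply: E0E.
  exact: hconst_mem.
have f_gt : val_gt f.[th] 0.
  rewrite !hornerE [r^-1 * _]mulrC; apply/val_gtP; split.
    by apply: val_geB => //; apply: val_ge_monom.
  by rewrite hcoefB subrr.
have := as_val_gt fE f_gt => /val_gtB /(_ f_gt).
have -> : f.[th + 1] - f.[th] = y / r.
  by rewrite !hornerE opprB addrA subrK /y deltaE mulrBl ![_ / r]mulrC.
move=> h; exfalso; have : val_gt (1 : hahn k) 0.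
  by rewrite -[1](subKr (y / r)); apply: val_gtB.
by move=> /(_ 0); rewrite hcoef1 eqxx oner_eq0 ltxx => /(_ isT).
Qed.

End ArtinSchreierValuation.

(** * The series alpha and eta *)

Section AlphaEta.
Variables (k : closedFieldType) (p : nat) (charp : p \in [pchar k]).
Implicit Types (s t : hahn k) (n N M : nat).

Let p_pr : prime p. Proof. exact: pcharf_prime charp. Qed.
Let p_gt0 : (0 < p)%N. Proof. exact: prime_gt0. Qed.
Let p_gt0Q : 0 < p%:R :> rat. Proof. by rewrite ltr0n. Qed.
Let p_neq0 : p%:R != 0 :> rat. Proof. exact: lt0r_neq0. Qed.
Let charH : p \in [pchar (hahn k)]. Proof. exact: pchar_hahn. Qed.

Local Notation al := (alpha k p).
Local Notation et := (eta k p).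

Definition pexp n : rat := (p%:R ^+ n)^-1.

Lemma pexpS n : p%:R * pexp n.+1 = pexp n.
Proof. by rewrite /pexp exprS invfM mulrA mulfV // mul1r. Qed.

Lemma pexp0 : pexp 0 = 1. Proof. by rewrite /pexp expr0 invr1. Qed.

Lemma pexp_pos n : 0 < pexp n.
Proof. by rewrite invr_gt0 exprn_gt0. Qed.

Lemma pexp_le m n : (m <= n)%N -> pexp n <= pexp m.
Proof.
move=> mn; rewrite lef_pV2 ?posrE ?exprn_gt0 // -!natrX ler_nat.
by rewrite leq_exp2l // prime_gt1.
Qed.

Lemma pexp_lt m n : (m < n)%N -> pexp n < pexp m.
Proof.
move=> mn; rewrite ltf_pV2 ?posrE ?exprn_gt0 // -!natrX ltr_nat.
by rewrite ltn_exp2l // prime_gt1.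
Qed.

Lemma pexp_inj : injective pexp.
Proof.
move=> m n e; case: (ltngtP m n) => // h; have := pexp_lt h;
  by rewrite e ltxx.
Qed.

Lemma pexp_small (e : rat) : 0 < e -> exists N, forall n, (N <= n)%N -> pexp n < e.
Proof.
move=> e0; exists (Num.bound e^-1) => n Nn.
rewrite -[e]invrK ltf_pV2 ?posrE ?invr_gt0 ?exprn_gt0 //.
apply: lt_le_trans (archi_boundP _) _; first by rewrite invr_ge0 ltW.
rewrite -natrX ler_nat (leq_trans Nn) // ltnW //; apply: ltn_expl.
exact: prime_gt1.
Qed.

Lemma pexp_small2 (e : rat) : 0 < e ->
  exists N, forall n, (N <= n)%N -> 2 * pexp n < e.
Proof.
move=> e0; have [|N h] := @pexp_small (e / 2); first by rewrite divr_gt0.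
by exists N => n /h; rewrite ltr_pdivlMr // mulrC.
Qed.

Lemma frobD s t : (s + t) ^+ p = s ^+ p + t ^+ p.
Proof. by rewrite -!(pFrobenius_autE charH) rmorphD. Qed.

Lemma frobB s t : (s - t) ^+ p = s ^+ p - t ^+ p.
Proof. by rewrite -!(pFrobenius_autE charH) rmorphB. Qed.

(** If the value [m] of [s] were below [c <= 0], the term of [s^p] at [p m < m] could not be
    cancelled by [s], so [t] would have an exponent below [p c]. *)
Lemma as_val_bound s t c : c <= 0 -> s ^+ p - s = t -> val_ge t (p%:R * c) ->
  val_ge s c.
Proof.
move=> c0 st tc; have [->|/val_exists[m [sm lm]]] := eqVneq s 0.
  exact: val_ge0.
apply: (val_ge_trans _ lm); rewrite leNgt; apply/negP => mc.
have := tc (p%:R * m); rewrite -st hcoefB (hcoefX_val _ lm).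
have -> : s (p%:R * m) = 0.
  apply/eqP/negPn/negP => /lm; rewrite leNgt => /negP; apply.
  rewrite -subr_lt0 -{2}[m]mul1r -mulrBl pmulr_rlt0 ?(lt_le_trans mc) //.
  by rewrite subr_gt0 ltr1n prime_gt1.
rewrite subr0 expf_neq0 // => /(_ isT).
by rewrite ler_pM2l // leNgt mc.
Qed.

Definition al_trunc n : hahn k := \sum_(i < n) ypow k (- pexp i.+1).
(** By [al_tailX] each of these is the [p]-th power of the next, so [al_tail n] is the root
    [u_n = alpha^(1/p^n)]. *)
Definition al_tail n : hahn k := al - al_trunc n.

Lemma al_tailS n : al_tail n = al_tail n.+1 + ypow k (- pexp n.+1).
Proof. by rewrite /al_tail /al_trunc big_ord_recr /= opprD addrA subrK. Qed.

Lemma ypowX n : ypow k (- pexp n.+1) ^+ p = ypow k (- pexp n).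
Proof. by rewrite hmonomX expr1n mulrN pexpS. Qed.

Lemma al_tail_AS n : al_tail n ^+ p - al_tail n = ypow k (- pexp n).
Proof.
elim: n => [|n IH].
  by rewrite /al_tail /al_trunc big_ord0 subr0 alpha_AS // pexp0.
move: IH; rewrite al_tailS frobD ypowX => IH.
rewrite -[RHS](subrK (ypow k (- pexp n))) -{2}IH; ring.
Qed.

Lemma al_tailX n : al_tail n.+1 ^+ p = al_tail n.
Proof.
by rewrite (al_tailS n) -(al_tail_AS n.+1) addrC subrK.
Qed.

Lemma al_tail_val n : val_ge (al_tail n) (- pexp n.+1).
Proof.
apply: as_val_bound (al_tail_AS n) _; first by rewrite oppr_le0 ltW ?pexp_pos.
by rewrite mulrN pexpS; apply: val_ge_monom.
Qed.

Definition et_trunc N : hahn k := \sum_(i < N) al_tail i.+1 ^+ 2.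

Lemma et_tail_AS N :
  (et - et_trunc N) ^+ p - (et - et_trunc N) = al_tail N ^+ 2.
Proof.
elim: N => [|N IH].
  by rewrite /al_tail /al_trunc /et_trunc !big_ord0 !subr0 eta_AS.
have -> : et - et_trunc N.+1 = et - et_trunc N - al_tail N.+1 ^+ 2.
  by rewrite /et_trunc big_ord_recr /= opprD addrA.
rewrite frobB -exprM mulnC exprM al_tailX -IH; ring.
Qed.

Lemma et_tail_val N : val_ge (et - et_trunc N) (- (2 * pexp N.+2)).
Proof.
apply: as_val_bound (et_tail_AS N) _.
  by rewrite oppr_le0 mulr_ge0 // ltW ?pexp_pos.
rewrite mulrN mulrCA pexpS -mulrN; apply: val_geX; exact: al_tail_val.
Qed.

(** Comparing coefficients in [alpha_AS] gives a recursion along [q |-> q / p], started by the term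
    [y^-1]; Frobenius is injective on [k]. *)
Lemma al_coef M : al (- pexp M.+1) = 1.
Proof.
have al_val : val_ge al (- pexp 1).
  by have := @al_tail_val 0; rewrite /al_tail /al_trunc big_ord0 subr0.
have rec q : al (q / p%:R) ^+ p = al q + (ypow k (- 1)) q.
  have := congr1 (fun s : hahn k => s q) (alpha_AS charp).
  by rewrite hcoefB hcoefXp // => /eqP; rewrite subr_eq addrC => /eqP.
have pexpV n : - pexp n.+1 = - pexp n / p%:R.
  by rewrite -(pexpS n) mulNr [p%:R * _]mulrC mulfK.
have inj1 (x : k) : x ^+ p = 1 -> x = 1.
  rewrite -[in X in _ = X -> _](expr1n _ p) -!(pFrobenius_autE charp).
  exact: fmorph_inj.
elim: M => [|M IH]; apply: inj1; rewrite pexpV rec /=.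
  rewrite pexp0; have -> : al (- 1) = 0; last by rewrite add0r.
  apply/eqP/negPn/negP => /al_val; rewrite lerN2 -pexp0 leNgt.
  by rewrite pexp_lt.
rewrite IH; case: eqP => [/oppr_inj e|]; last by rewrite addr0.
by have := pexp_lt (ltn0Sn M); rewrite pexp0 e ltxx.
Qed.

Lemma al_trunc_coef n M : al_trunc n (- pexp M.+1) = (M < n)%:R.
Proof.
rewrite hcoef_sum /=.
under eq_bigr => i _ do rewrite eqr_opp (inj_eq pexp_inj) eqSS.
have [Mn|nM] := ltnP M n.
  rewrite (bigD1 (Ordinal Mn)) //= eqxx big1 ?addr0 // => i iM.
  by rewrite eq_sym; case: eqP => // e; case/eqP: iM; apply: val_inj.
rewrite big1 // => i _; case: eqP => // e.
by have := ltn_ord i; rewrite -e ltnNge nM.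
Qed.

Lemma al_tail_coef n M : al_tail n (- pexp M.+1) = (n <= M)%:R.
Proof.
by rewrite hcoefB al_coef al_trunc_coef ltnNge; case: (n <= M)%N; rewrite ?subr0 ?subrr.
Qed.

(** * The tower obtained by adjoining [alpha] and [eta] to [K] *)

Variables (K : set (hahn k)) (hK : is_subfield K).
Hypotheses (kyK : rat_subfield k `<=` K) (hensK : henselian K).
Hypothesis perfK : perfect p K.
Variables (R : realType) (nflK : no_finite_limits R K).
Local Notation E0 := (subfield_pred hK : divringClosed (hahn k)).

Lemma ypow_pexp_mem n : ypow k (- pexp n) \in E0.
Proof.
elim: n => [|n IH].
  by have := ypow_int_mem hK kyK (- 1); rewrite mulrNz pexp0.
have [b bK bp] := perfK ((mem_subfield_pred hK _).1 IH).
suff -> : ypow k (- pexp n.+1) = b by apply/mem_subfield_pred.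
by apply: (hexp_inj charp (m := 1)); rewrite /= expn1 bp ypowX.
Qed.

Lemma al_trunc_mem n : al_trunc n \in E0.
Proof. by apply: rpred_sum => i _; apply: ypow_pexp_mem. Qed.

(** The exponents [- p^-(M+1)] tend to [0], which would be an accumulation point of the support. *)
Lemma no_limit_at0 a : a \in E0 ->
  ~ (forall N, exists2 M, (N <= M)%N & a (- pexp M.+1) != 0).
Proof.
move=> /mem_subfield_pred /nflK h H.
suff : limit_point [set (ratr q : R) | q in hsupp a] 0 by rewrite h.
move=> A /nbhs_ballP[e /= e0 eA].
have [M NM aM] := H (Num.bound e^-1).
exists (ratr (- pexp M.+1)); split; last 1 first.
- apply: eA; rewrite /ball /= sub0r -rmorphN opprK.
  rewrite ger0_norm; last by rewrite ler0q ltW ?pexp_pos.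
  rewrite /pexp fmorphV rmorphXn /= ratr_nat -[e]invrK.
  rewrite ltf_pV2 ?posrE ?invr_gt0 ?exprn_gt0 ?ltr0n //.
  apply: lt_le_trans (archi_boundP _) _; first by rewrite invr_ge0 ltW.
  rewrite -natrX ler_nat (leq_trans NM) // ltnW //.
  by apply: leq_ltn_trans (leqnSn M) _; apply: ltn_expl; apply: prime_gt1.
- by rewrite fmorph_eq0 oppr_eq0 lt0r_neq0 ?pexp_pos.
- by exists (- pexp M.+1).
Qed.

Hypothesis p_gt2 : (2 < p)%N.

Lemma alpha_notin : al \notin E0.
Proof.
apply/negP => /no_limit_at0; apply => N; exists N => //.
by rewrite al_coef oner_eq0.
Qed.

Lemma alpha_AS_mem : al ^+ p - al \in E0.
Proof. by rewrite alpha_AS // -[1]pexp0 ypow_pexp_mem. Qed.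

Lemma alpha_algebraic : al \in algebraic_over E0.
Proof. exact: (as_algebraic charH alpha_AS_mem). Qed.

Local Notation L := (ext_pred alpha_algebraic : divringClosed (hahn k)).

Lemma sub_L x : x \in E0 -> x \in L. Proof. exact: sub_simple_ext. Qed.

Lemma L_algebraic x : x \in L -> x \in algebraic_over E0.
Proof. exact: simple_ext_algebraic alpha_algebraic. Qed.

Lemma al_tail_mem n : al_tail n \in L.
Proof.
by rewrite rpredB //; [exact: gen_simple_ext | exact/sub_L/al_trunc_mem].
Qed.

Lemma et_trunc_mem N : et_trunc N \in L.
Proof. by apply: rpred_sum => i _; rewrite rpredX ?al_tail_mem. Qed.

Lemma alpha_approx (e : rat) : 0 < e -> exists2 a, a \in E0 & val_ge (al - a) (- e).
Proof.
move=> e0; have [N h] := pexp_small e0; exists (al_trunc N).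
  exact: al_trunc_mem.
apply: val_ge_trans (@al_tail_val N).
by rewrite lerN2 ltW // h.
Qed.

Lemma eta_approx (e : rat) : 0 < e -> exists N0, forall N, (N0 <= N)%N ->
  val_ge (et - et_trunc N) (- e).
Proof.
move=> e0; have [N0 h] := pexp_small2 e0; exists N0 => N N0N.
apply: val_ge_trans (@et_tail_val N).
by rewrite lerN2 ltW // h // (leq_trans N0N) // -addn2 leq_addr.
Qed.

Lemma eta_AS_mem : et ^+ p - et \in L.
Proof. by rewrite eta_AS // rpredX //; exact: gen_simple_ext. Qed.

Let aE0 x : x \in E0 -> x \in algebraic_over E0. Proof. exact: sub_algebraic. Qed.

Let alpha_val_ge := @as_val_ge k p charp K hK kyK hensK E0 al (fun _ => id) aE0
  alpha_notin alpha_AS_mem alpha_algebraic.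

Definition ze_trunc N : hahn k := \sum_(i < N) al_tail i.+1.

Lemma ze_trunc_coef N M : (M <= N)%N -> ze_trunc N (- pexp M.+1) = M%:R.
Proof.
move=> MN; rewrite hcoef_sum; under eq_bigr => i _ do rewrite al_tail_coef.
rewrite -natr_sum; congr _%:R.
have -> : (\sum_(i < N) (i.+1 <= M))%N = (\sum_(i < N | i < M) 1)%N.
  by rewrite [RHS]big_mkcond; apply: eq_bigr => i _; case: ltnP.
by rewrite -(big_ord_widen N (fun _ => 1%N)) // sum_nat_const card_ord muln1.
Qed.

Lemma val_ge_ltN s (c d : rat) : d < c -> val_ge s c -> s d = 0.
Proof.
by move=> dc sc; apply/eqP/negPn/negP => /sc; rewrite leNgt dc.
Qed.

(* If eta + Q(alpha) were approximated by K up to value 0, so would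
   Q(alpha + 1) - Q(alpha) + 2 zeta, where zeta = sum_n alpha^(1/p^n) and
   ze_trunc N are its partial sums; repeating the argument, some element of K
   has coefficient M - omega at - p^-(M+1) for all M. *)
Lemma eta_plus_not_approx (Q : {poly hahn k}) : Q \is a polyOver E0 ->
  (size Q <= p)%N ->
  ~ (forall e : rat, 0 < e ->
       exists2 a, a \in E0 & val_ge (et + Q.[al] - a) (- e)).
Proof.
move=> QE Qp H.
have step1 (e : rat) : 0 < e -> exists N0, forall N, (N0 <= N)%N ->
    val_ge ((delta Q).[al] + 2 * ze_trunc N) (- e).
  move=> e0; have [N0 hN] := eta_approx e0; exists N0 => N /hN et_ge.
  have [a aE Qa] := H e e0.
  (* [g(alpha)] is a partial sum of [eta] plus [Q(alpha) - a]; passing to [alpha + 1] changes each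
     square [u_i^2] by [2 u_i + 1]. *)
  pose g := \sum_(i < N) ('X - (al_trunc i.+1)%:P) ^+ 2 + Q - a%:P.
  have gE : g \is a polyOver E0.
    rewrite rpredB ?polyOverC // rpredD // rpred_sum // => i _.
    by rewrite rpredX // rpredB ?polyOverX ?polyOverC ?al_trunc_mem.
  have gx x : g.[x] = \sum_(i < N) (x - al_trunc i.+1) ^+ 2 + Q.[x] - a.
    rewrite !hornerE horner_sum; congr (_ + _ - _).
    by apply: eq_bigr => i _; rewrite !hornerE.
  have ga : val_ge g.[al] (- e).
    have -> : g.[al] = (et + Q.[al] - a) - (et - et_trunc N).
      by rewrite gx -/(et_trunc N); ring.
    exact: val_geB.
  have := val_geB (alpha_val_ge gE ga) ga.
  have -> : g.[al + 1] - g.[al] = (delta Q).[al] + 2 * ze_trunc N + N%:R.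
    rewrite !gx deltaE.
    have -> : \sum_(i < N) (al + 1 - al_trunc i.+1) ^+ 2 =
        \sum_(i < N) (al - al_trunc i.+1) ^+ 2 + 2 * ze_trunc N + N%:R.
      rewrite /ze_trunc mulr_sumr -big_split /=.
      have -> : N%:R = \sum_(i < N) (1 : hahn k).
        by rewrite sumr_const card_ord.
      by rewrite -big_split /=; apply: eq_bigr => i _; rewrite /al_tail; ring.
    ring.
  move=> h; rewrite -[X in val_ge X _](addrK N%:R); apply: val_geB => //.
  by apply: val_ge_trans (@val_ge_nat k N); rewrite oppr_le0 ltW.
(* This is [- 1/2], written in the form covered by [val_ge_inv_natB]. *)
pose c2 : hahn k := (0%:R - 2%:R)^-1.
have c2_ge : val_ge c2 0 by apply: (val_ge_inv_natB charp).
have c2E : c2 \in E0 by rewrite rpredV rpredB ?rpred_nat.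
have two0 : (2 : hahn k) != 0.
  rewrite -(dvdn_pcharf charH); apply/negP => /(dvdn_leq (isT : 0 < 2)%N).
  by rewrite leqNgt p_gt2.
have c22 : c2 * 2 = - 1 by rewrite /c2 sub0r invrN mulNr mulVf.
pose Q' := c2 *: delta Q.
have dQE : delta Q \is a polyOver E0 by apply: polyOver_delta.
have Q'E : Q' \is a polyOver E0 by rewrite polyOverZ.
have size_d (f : {poly hahn k}) : (size f <= p)%N -> (size (delta f) <= p)%N.
  have [->|/size_delta h] := eqVneq f 0.
    by rewrite /delta comp_poly0 subr0.
  by move=> fp; apply: ltnW; apply: leq_trans fp.
have Q'p : (size Q' <= p)%N by rewrite (leq_trans (size_scale_leq _ _)) ?size_d.
have step2 (e : rat) : 0 < e -> exists N0, forall N, (N0 <= N)%N ->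
    val_ge (Q'.[al] - ze_trunc N) (- e).
  move=> e0; have [N0 h] := step1 e e0; exists N0 => N /h hN.
  have := val_geM c2_ge hN; rewrite add0r.
  suff -> : c2 * ((delta Q).[al] + 2 * ze_trunc N) = Q'.[al] - ze_trunc N by [].
  by rewrite hornerZ mulrDr mulrA c22 mulN1r.
(* Now [alpha |-> alpha + 1] changes each [u_i] by [1], hence the truncated sum only by the integer
   [N]. *)
have dQ'_ge : val_ge (delta Q').[al] 0.
  apply: val_ge_dense => e e0; rewrite sub0r.
  have [N h] := step2 e e0; have {}h := h N (leqnn N).
  pose g := Q' - \sum_(i < N) ('X - (al_trunc i.+1)%:P).
  have gE : g \is a polyOver E0.
    rewrite rpredB // rpred_sum // => i _.
    by rewrite rpredB ?polyOverX ?polyOverC ?al_trunc_mem.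
  have gx x : g.[x] = Q'.[x] - \sum_(i < N) (x - al_trunc i.+1).
    rewrite hornerD hornerN horner_sum; congr (_ - _).
    by apply: eq_bigr => i _; rewrite !hornerE.
  have ga : val_ge g.[al] (- e) by rewrite gx.
  have := val_geB (alpha_val_ge gE ga) ga.
  have -> : g.[al + 1] - g.[al] = (delta Q').[al] - N%:R.
    rewrite !gx deltaE.
    have -> : \sum_(i < N) (al + 1 - al_trunc i.+1) =
        \sum_(i < N) (al - al_trunc i.+1) + N%:R.
      have -> : N%:R = \sum_(i < N) (1 : hahn k).
        by rewrite sumr_const card_ord.
      by rewrite -big_split /=; apply: eq_bigr => i _; ring.
    ring.
  move=> h'; rewrite -[X in val_ge X _](subrK N%:R); apply: val_geD => //.
  by apply: val_ge_trans (@val_ge_nat k N); rewrite oppr_le0 ltW.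
clearbody Q'.
(* Subtracting [om X] removes the residue of [delta Q' (alpha)], so that [as_approx] gives [a] in
   [K] with [Q'(alpha) - om alpha - a] of positive value. *)
pose om := (delta Q').[al] 0.
pose Q2 := Q' - (hconst om)%:P * 'X.
have omE : hconst om \in E0 by apply: hconst_mem.
have Q2E : Q2 \is a polyOver E0.
  by rewrite rpredB // rpredM ?polyOverC ?polyOverX.
have Q2p : (size Q2 <= p)%N.
  rewrite (leq_trans (size_polyD _ _)) // size_polyN geq_max Q'p.
  rewrite mul_polyC (leq_trans (size_scale_leq _ _)) // size_polyX.
  exact: prime_gt1.
have dQ2 : val_gt (delta Q2).[al] 0.
  have -> : (delta Q2).[al] = (delta Q').[al] - hconst om.
    by rewrite !deltaE !hornerE; ring.
  apply/val_gtP; split; first by apply: val_geB => //; apply: val_ge_monom.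
  by rewrite hcoefB subrr.
have [a aE Q2a] := @as_approx k p charp K hK kyK hensK E0 al (fun _ => id) aE0
  alpha_notin alpha_AS_mem alpha_algebraic alpha_approx Q2 0 Q2E Q2p dQ2.
have a_coef M : a (- pexp M.+1) = M%:R - om.
  have := val_ge_ltN (d := - pexp M.+1) _ (val_gtW Q2a).
  rewrite oppr_lt0 pexp_pos hcoefB => /(_ isT) /eqP; rewrite subr_eq0 => /eqP <-.
  rewrite !(hornerE, hcoefB) hcoef_monomM subr0 al_coef mulr1; congr (_ - _).
  (* Precision [pexp M.+2] reaches beyond the exponent [- pexp M.+1], where the truncated sum has
     coefficient [M] once [N >= M]. *)
  have [N0 h] := step2 (pexp M.+2) (pexp_pos _).
  have {}h := h (maxn N0 M) (leq_maxl _ _).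
  have := val_ge_ltN (d := - pexp M.+1) _ h; rewrite ltrN2 pexp_lt //.
  rewrite hcoefB ze_trunc_coef ?leq_maxr // => /(_ isT) /eqP.
  by rewrite subr_eq0 => /eqP.
apply: (no_limit_at0 aE) => N.
(* Consecutive coefficients differ by [1], so they cannot both vanish. *)
have [N0|N0] := eqVneq (a (- pexp N.+1)) 0; last by exists N.
exists N.+1; first exact: leqnSn.
move: N0; rewrite !a_coef => N0.
by rewrite -natr1 addrAC N0 add0r oner_eq0.
Qed.

Lemma eta_notin : et \notin L.
Proof.
apply/negP => /(as_repr charH alpha_AS_mem)[g [gE gp etg]].
apply: (@eta_plus_not_approx (- g)); rewrite ?rpredN ?size_polyN // => e e0.
by exists 0; rewrite ?rpred0 // hornerN -etg subrr subr0; exact: val_ge0.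
Qed.

Lemma eta_algebraic : et \in algebraic_over E0.
Proof.
have /algebraic_overP[f [fE f0 fx]] : al ^+ 2 \in algebraic_over E0.
  by rewrite rpredX ?alpha_algebraic.
apply/algebraic_overP; exists (f \Po ('X^p - 'X)); split.
- by rewrite polyOver_comp // rpredB ?rpredX ?polyOverX.
- rewrite comp_poly_eq0 // size_polyDl size_polyXn ltnS ?size_polyN ?size_polyX //.
  exact: prime_gt1.
- by rewrite /root horner_comp !hornerE eta_AS.
Qed.


(** Let [y] be the monomial of exponent [- 1/p^2], so that [u_1 = u_2 + y]. Up to value [- 1/p^2],
    [eta] agrees with [u_1^2] and [u_2^2] is negligible, so [b] agrees with [y^2 + 2 y u_2]. Solving
    for [alpha] means dividing by [2 y], which leaves an error of value [>= 0] and contradicts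
    [as_distance] over [K(b)]. *)
Lemma alpha_in_ext b : b \in algebraic_over E0 ->
  val_ge (et - b) (- pexp 2) -> al \in simple_ext E0 b.
Proof.
move=> ab etb; apply/negPn/negP => al_notin.
pose E := ext_pred ab : divringClosed (hahn k).
have E0E x : x \in E0 -> x \in E by apply: sub_simple_ext.
have aE x : x \in E -> x \in algebraic_over E0 by apply: simple_ext_algebraic ab.
have asE : al ^+ p - al \in E by apply: E0E; apply: alpha_AS_mem.
pose y := ypow k (- pexp 2).
have yE : y \in E by apply/E0E/ypow_pexp_mem.
have y0 : y != 0 by exact: ypow_neq0.
have two0 : (2 : hahn k) != 0.
  rewrite -(dvdn_pcharf charH); apply/negP => /(dvdn_leq (isT : 0 < 2)%N).
  by rewrite leqNgt p_gt2.
have h2 : 2 * pexp 3 <= pexp 2.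
  by rewrite -(pexpS 2) ler_pM2r ?pexp_pos // ler_nat ltnW.
have et1 : val_ge (et - al_tail 1 ^+ 2) (- pexp 2).
  have := @et_tail_val 1; rewrite /et_trunc big_ord_recr big_ord0 /= add0r.
  by apply: val_ge_trans; rewrite lerN2.
have u2 : val_ge (al_tail 2 ^+ 2) (- pexp 2).
  by apply: val_ge_trans (val_geX (n := 2) (@al_tail_val 2)); rewrite mulrN lerN2.
pose be := al_trunc 2 + (b - y ^+ 2) / (2 * y).
have beE : be \in E.
  have bE : b \in E by exact: gen_simple_ext.
  apply: rpredD; first exact/E0E/al_trunc_mem.
  apply: rpred_div; first by apply: rpredB => //; apply: rpredX.
  by apply: rpredM => //; apply: rpred_nat.
have := val_geB (val_geB etb et1) u2.
have -> : et - b - (et - al_tail 1 ^+ 2) - al_tail 2 ^+ 2 = (2 * y) * (al - be).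
  rewrite (al_tailS 1) -/y /be /al_tail; field.
  by rewrite y0 two0.
rewrite -[- pexp 2]addr0 => h.
apply: (@as_distance k p charp K hK kyK hensK E al E0E aE al_notin asE
  alpha_algebraic be beE).
apply: val_ge_mulKl h; rewrite mulr_natl.
  rewrite hcoefMn /y /= eqxx -[1 *+ 2]/(2%:R) -(dvdn_pcharf charp).
  apply/negP => /(dvdn_leq (isT : 0 < 2)%N).
  by rewrite leqNgt p_gt2.
exact/val_geMn/val_ge_monom.
Qed.

(** Once [alpha] lies in [K(b)], [eta] satisfies an Artin-Schreier equation over [K(b)], and
    [as_distance] applies to [b] itself. *)
Lemma eta_in_ext b : b \in algebraic_over E0 -> val_ge (et - b) 0 ->
  al \in simple_ext E0 b /\ et \in simple_ext E0 b.
Proof.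
move=> ab etb; have al_in : al \in simple_ext E0 b.
  apply: alpha_in_ext => //; apply: val_ge_trans etb.
  by rewrite oppr_le0 ltW ?pexp_pos.
split=> //; apply/negPn/negP => et_notin.
pose E := ext_pred ab : divringClosed (hahn k).
have E0E x : x \in E0 -> x \in E by apply: sub_simple_ext.
have aE x : x \in E -> x \in algebraic_over E0 by apply: simple_ext_algebraic ab.
have asE : et ^+ p - et \in E.
  by rewrite eta_AS //; apply: (rpredX (S := E)).
apply: (@as_distance k p charp K hK kyK hensK E et E0E aE et_notin asE
  eta_algebraic b) => //.
exact: gen_simple_ext.
Qed.

Lemma generator_L_closer th : th \in simple_ext L et -> th \notin L ->
  exists2 b, b \in L & forall a, a \in E0 -> (hval (th - a)%R < hval (th - b)%R)%E.
Proof.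
move=> /(as_repr charH eta_AS_mem)[f [fL fp ->]] thL; apply: contrapT => H.
have et_approx (e : rat) : 0 < e -> exists2 a, a \in L & val_ge (et - a) (- e).
  move=> /eta_approx[N h]; exists (et_trunc N); first exact: et_trunc_mem.
  exact: h.
have df0 : delta f != 0.
  apply: contraNneq thL => /(delta_eq0 charH fp) ->; rewrite hornerC.
  exact/polyOverP.
have dfL : delta f \is a polyOver L by apply: polyOver_delta.
have dfp : (size (delta f) <= p)%N.
  have f0 : f != 0 by apply: contraNneq df0 => ->; rewrite /delta comp_poly0 subr0.
  by rewrite (leq_trans (ltnW (size_delta f0))).
(* Immediacy is used twice: [delta f (eta)] is close to some [r] in [L], and [r] to some [s] in [K],
   each up to a factor of residue [1]. *)
have [r [rL r0 r_gt]] := @as_immediate k p charp K hK kyK hensK L et sub_L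
  L_algebraic eta_notin eta_AS_mem eta_algebraic et_approx _ dfL dfp df0.
have [g [gE gp rg]] := as_repr charH alpha_AS_mem rL.
have g0 : g != 0 by apply: contraNneq r0 => g0; rewrite rg g0 horner0.
have [s [sE s0 s_gt]] := @as_immediate k p charp K hK kyK hensK E0 al
  (fun _ => id) aE0 alpha_notin alpha_AS_mem alpha_algebraic alpha_approx
  _ gE gp g0.
rewrite -rg in s_gt.
(* After division by [s], [delta f (eta)] is close to [1], the difference of [X]; so [delta h (eta)]
   has positive value and [h(eta)] is close to some [e] in [L]. *)
pose h := s^-1 *: f - 'X.
have hE x : h.[x] = f.[x] / s - x by rewrite !hornerE mulrC.
have sL : s \in L by apply: sub_L.
have hL : h \is a polyOver L by rewrite rpredB ?polyOverX // polyOverZ ?rpredV.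
have hp : (size h <= p)%N.
  rewrite (leq_trans (size_polyD _ _)) // size_polyN geq_max size_polyX.
  by rewrite (leq_trans (size_scale_leq _ _)) // prime_gt1.
have dh_gt : val_gt (delta h).[et] 0.
  have -> : (delta h).[et] = ((delta f).[et] / r - 1) * (r / s) + (r / s - 1).
    rewrite !deltaE !hE; field.
    by rewrite r0 s0.
  apply: val_gtD => //; rewrite -[0]addr0; apply: val_gtM => //.
  rewrite -[r / s](subrK 1); apply: val_geD; [exact: val_gtW | exact: val_ge1].
have [e eL he] := @as_approx k p charp K hK kyK hensK L et sub_L
  L_algebraic eta_notin eta_AS_mem eta_algebraic et_approx h 0 hL hp dh_gt.
have [m [sm lm]] := val_exists s0.
have [Q [QE Qp eQ]] := as_repr charH alpha_AS_mem eL.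
apply: (eta_plus_not_approx QE Qp) => eps eps0.
have [N hN] := eta_approx eps0; have {}hN := hN N (leqnn N).
(* [b] approximates [f(eta)] up to value [m - eps], with [m] the value of [s]. By the negated goal
   some [a] in [K] does as well, and then [a / s] approximates [eta + e]. *)
pose b := s * (e + et_trunc N).
have bL : b \in L by rewrite rpredM // rpredD // et_trunc_mem.
have fb_ge : val_ge (f.[et] - b) (m - eps).
  have -> : f.[et] - b = s * ((h.[et] - e) + (et - et_trunc N)).
    by rewrite hE /b; field.
  apply: val_geM => //; apply: val_geD => //.
  by apply: val_ge_trans (val_gtW he); rewrite oppr_le0 ltW.
have [a aE le_a] : exists2 a, a \in E0 & (hval (f.[et] - b)%R <= hval (f.[et] - a)%R)%E.
  apply: contrapT => H'; apply: H; exists b => // a aE; rewrite ltNge.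
  by apply/negP => le_a; apply: H'; exists a.
exists (a / s); first by rewrite rpred_div.
have fa_ge : val_ge (f.[et] - a) (m - eps).
  by apply/val_geE; apply: le_trans le_a; apply/val_geE.
have fas : val_ge (f.[et] / s - a / s) (- eps).
  apply: (val_ge_mulKl sm lm); rewrite -mulrBl mulrCA divff // mulr1.
  exact: fa_ge.
rewrite -eQ; have -> : et + e - a / s = (f.[et] / s - a / s) - (h.[et] - e).
  by rewrite hE; ring.
apply: val_geB => //.
by apply: val_ge_trans (val_gtW he); rewrite oppr_le0 ltW.
Qed.

End AlphaEta.

(** * Degrees and depth *)

Section DegreeBounds.
Variables (k : closedFieldType) (p : nat) (charp : p \in [pchar k]).

Let p_pr : prime p. Proof. exact: pcharf_prime charp. Qed.
Let p_gt0 : (0 < p)%N. Proof. exact: prime_gt0. Qed.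
Let charH : p \in [pchar (hahn k)]. Proof. exact: pchar_hahn. Qed.

Local Notation al := (alpha k p).
Local Notation et := (eta k p).

Variables (K : set (hahn k)) (hK : is_subfield K).
Hypotheses (kyK : rat_subfield k `<=` K) (hensK : henselian K).
Hypothesis perfK : perfect p K.
Variables (R : realType) (nflK : no_finite_limits R K).
Hypothesis p_gt2 : (2 < p)%N.
Local Notation E0 := (subfield_pred hK : divringClosed (hahn k)).

Let al_notin := alpha_notin charp hK nflK.
Let al_AS := alpha_AS_mem charp hK kyK perfK.
Let al_alg := alpha_algebraic charp hK kyK perfK.
Local Notation L := (ext_pred al_alg : divringClosed (hahn k)).
Let et_notin := eta_notin charp hK kyK hensK perfK nflK p_gt2.
Let et_AS := eta_AS_mem charp hK kyK perfK.
Let et_alg := eta_algebraic charp hK kyK perfK.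

(** The powers of [x] with exponents [0] to [p] lie in the span of [p] powers of [alpha]; a relation
    among them is a polynomial killing [x]. *)
Lemma L_degree x : x \in L -> exists2 n, deg_is K x n & (n <= p)%N.
Proof.
move=> xL.
have [||c [cE [i0 ci0] c0]] := @linear_dep _ E0 'I_p.+1 p (fun j => al ^+ j)
    (fun i => x ^+ i).
- move=> i; have xiL : x ^+ i \in simple_ext E0 al by apply: (rpredX (S := L)).
  have [f [/polyOverP fE fp ->]] := as_repr charH al_AS xiL.
  by exists (fun j : 'I_p => f`_j) => //; apply: horner_coef_wide.
- by rewrite card_ord.
pose f := \poly_(i < p.+1) c (inord i).
have fE : f \is a polyOver E0.
  apply/polyOverP => i; rewrite coef_poly; case: ifP => _; first exact: cE.
  exact: rpred0.
have f0 : f != 0.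
  apply: contraNneq ci0 => /(congr1 (fun g : {poly hahn k} => g`_i0)).
  by rewrite coef_poly ltn_ord inord_val coef0 => ->.
have fx : root f x.
  apply/rootP; rewrite horner_poly -[RHS]c0; apply: eq_bigr => i _.
  by rewrite inord_val.
have [n xn np] := deg_is_le fE f0 fx; exists n => //.
by rewrite (leq_trans np) // -subn1 leq_subLR add1n size_poly.
Qed.

(** A polynomial of degree at most [p] killing [alpha^2], composed with [X^p - X], kills [eta]. *)
Lemma eta_degree_le : exists2 n, deg_is K et n & (n <= p ^ 2)%N.
Proof.
have al2 : al ^+ 2 \in L by rewrite rpredX //; exact: gen_simple_ext.
have [n [[f [fE f0 fal] fn] _] np] := L_degree al2.
pose q : {poly hahn k} := 'X^p - 'X.
have sq : size q = p.+1.
  rewrite size_polyDl size_polyXn // ltnS size_polyN size_polyX.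
  exact: prime_gt1.
have qE : q \is a polyOver E0 by rewrite rpredB ?rpredX ?polyOverX.
have fqE : f \Po q \is a polyOver E0 by apply: polyOver_comp.
have fq0 : f \Po q != 0.
  by rewrite comp_poly_eq0 // sq ltnS.
have fq_et : root (f \Po q) et.
  by rewrite /root horner_comp /q !hornerE eta_AS.
have [m etm mp] := deg_is_le fqE fq0 fq_et; exists m => //.
by rewrite (leq_trans mp) // size_comp_poly sq /= fn leq_mul.
Qed.

Lemma as_free (E : divringClosed (hahn k)) th (c : 'I_p -> hahn k) :
  th \notin E -> th ^+ p - th \in E -> (forall i, c i \in E) ->
  \sum_i c i * th ^+ i = 0 -> forall i, c i = 0.
Proof.
move=> thE asE cE c0.
pose e i := oapp c 0 (insub i : option 'I_p).
have eE (i : 'I_p) : e i = c i by rewrite /e valK.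
pose f := \poly_(i < p) e i.
have fE : f \is a polyOver E.
  apply/polyOverP => i; rewrite coef_poly; case: ifP => _; last exact: rpred0.
  by rewrite /e; case: insubP => [j _ _|_] /=; rewrite ?rpred0.
have f0 : f = 0.
  apply: (as_indep charH thE asE fE (size_poly _ _)).
  by rewrite horner_poly -[RHS]c0; apply: eq_bigr => i _; rewrite eE.
by move=> i; rewrite -eE; have := coef_poly p e i; rewrite ltn_ord -/f f0 coef0.
Qed.

Lemma degree_ge_p b n : deg_is K b n -> al \in simple_ext E0 b -> (p <= n)%N.
Proof.
move=> bn alb; rewrite -[p]card_ord.
apply: (deg_is_card (hK := hK) bn (x := fun i : 'I_p => al ^+ i)) => [i|].
  exact: (rpredX (S := ext_pred (deg_is_algebraic hK bn))).
by move=> c cE c0; apply: (as_free al_notin al_AS cE).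
Qed.

(** The products [alpha^i eta^j] are free over [K]: a relation is first read over [L] in powers of
    [eta], then over [K] in powers of [alpha]. *)
Lemma degree_ge_p2 b n : deg_is K b n -> al \in simple_ext E0 b ->
  et \in simple_ext E0 b -> (p ^ 2 <= n)%N.
Proof.
move=> bn alb etb; pose ab := deg_is_algebraic hK bn.
have -> : (p ^ 2 = #|{: 'I_p * 'I_p}|)%N by rewrite card_prod card_ord.
apply: (deg_is_card (hK := hK) bn
  (x := fun ij : 'I_p * 'I_p => al ^+ ij.1 * et ^+ ij.2)) => [[i j]|].
  by apply: (rpredM (s := ext_pred ab)); apply: (rpredX (S := ext_pred ab)).
move=> c cE c0.
have cj j : \sum_i c (i, j) * al ^+ i = 0.
  apply: (as_free (E := L) (c := fun j => \sum_i c (i, j) * al ^+ i) et_notin et_AS)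
    => [j'|].
    apply: rpred_sum => i _; apply: rpredM; first exact/sub_simple_ext/cE.
    by apply: rpredX; exact: gen_simple_ext.
  have {}c0 : \sum_i \sum_j c (i, j) * (al ^+ i * et ^+ j) = 0.
    by rewrite pair_bigA /= -[RHS]c0; apply: eq_bigr => -[].
  rewrite -[RHS]c0 exchange_big; apply: eq_bigr => j' _; rewrite mulr_suml.
  by apply: eq_bigr => i _; rewrite mulrA.
move=> [i j].
by apply: (as_free (c := fun i => c (i, j)) al_notin al_AS _ (cj j)) => i'; apply: cE.
Qed.

Lemma eta_degree : deg_is K et (p ^ 2).
Proof.
have [n etn np] := eta_degree_le.
have np_eq : n = (p ^ 2)%N; last by rewrite np_eq in etn.
apply/eqP; rewrite eqn_leq np andTb; have e0 c : val_ge (et - et) c.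
  by rewrite subrr; exact: val_ge0.
(* Taken at [b = eta], this puts [alpha] in [K(eta)]. *)
have [al_in et_in] := eta_in_ext charp kyK hensK perfK p_gt2 et_alg (e0 0).
exact: (degree_ge_p2 etn).
Qed.

(** For [N >= 1] the value of the error is at least [- 2/p^(N+2) >= - 1/p^2], so [alpha_in_ext]
    applies to the partial sum. *)
Lemma et_trunc_degree N : (0 < N)%N -> deg_is K (et_trunc k p N) p.
Proof.
move=> N0; have etL := et_trunc_mem charp hK kyK perfK N.
have [n etn np] := L_degree etL.
have np_eq : n = p; last by rewrite np_eq in etn.
apply/eqP; rewrite eqn_leq np /=; apply: (degree_ge_p etn).
apply: (alpha_in_ext charp kyK hensK perfK p_gt2).
  exact: deg_is_algebraic etn.
apply: val_ge_trans (et_tail_val charp (N := N)).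
rewrite lerN2 (le_trans _ (_ : 2 * pexp p 3 <= _)) //.
  by rewrite ler_pM2l // (pexp_le charp).
by rewrite -(pexpS charp 2) ler_pM2r ?(pexp_pos charp) // ler_nat ltnW.
Qed.

(** In [u_1^2 = y^2 + 2 y u_2 + u_2^2] the last term is negligible; the witness replaces [alpha] by
    [al_trunc n] inside [u_2], at the cost of [2 y u_n]. *)
Lemma eta_approx_K (e : rat) : 0 < e ->
  exists2 a, a \in E0 & val_ge (et - a) (- pexp p 2 - e).
Proof.
move=> e0; have [n hn] := pexp_small charp e0.
pose y := ypow k (- pexp p 2).
have yE : y \in E0 by apply: (ypow_pexp_mem charp).
exists (y ^+ 2 + 2 * y * (al_trunc k p n - al_trunc k p 2)).
  by rewrite rpredD ?rpredX // !rpredM ?rpred_nat // rpredB //; apply: (al_trunc_mem charp).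
have h2 : 2 * pexp p 3 <= pexp p 2.
  by rewrite -(pexpS charp 2) ler_pM2r ?(pexp_pos charp) // ler_nat ltnW.
have le_e : - pexp p 2 - e <= - pexp p 2 by rewrite gerBl ltW.
have et1 : val_ge (et - al_tail k p 1 ^+ 2) (- pexp p 2 - e).
  have := @et_tail_val k p charp 1; rewrite /et_trunc big_ord_recr big_ord0 /= add0r.
  by apply: val_ge_trans; rewrite (le_trans le_e) // lerN2.
have u2 : val_ge (al_tail k p 2 ^+ 2) (- pexp p 2 - e).
  apply: val_ge_trans (val_geX (n := 2) (@al_tail_val k p charp 2)).
  by rewrite mulrN (le_trans le_e) // lerN2.
have un : val_ge (2 * y * al_tail k p n) (- pexp p 2 - e).
  apply: val_geM.
    by rewrite mulr_natl; apply/val_geMn/val_ge_monom.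
  apply: val_ge_trans (@al_tail_val k p charp n).
  by rewrite lerN2 ltW // hn.
have -> : et - (y ^+ 2 + 2 * y * (al_trunc k p n - al_trunc k p 2)) =
   et - al_tail k p 1 ^+ 2 + al_tail k p 2 ^+ 2 + 2 * y * al_tail k p n.
  by rewrite (al_tailS k p 1) -/y /al_tail; ring.
by apply: val_geD => //; apply: val_geD.
Qed.

Lemma eta_depth_step1 : depth_step K et 1 p.
Proof.
have dist1 a : a \in E0 -> ~ val_ge (et - a) (- pexp p 2).
  move=> aE eta_a; move/negP: al_notin; apply.
  have /simple_extP[f fE ->] :=
    alpha_in_ext charp kyK hensK perfK p_gt2 (sub_algebraic aE) eta_a.
  rewrite horner_coef; apply: rpred_sum => i _; apply: rpredM; first exact/polyOverP.
  exact: rpredX.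
split.
  split; first exact: prime_gt1.
  exists (hval (et - et_trunc k p 1)).
    by exists (et_trunc k p 1) => //; apply: et_trunc_degree.
  move=> _ [a /(deg_is1_mem hK) /(mem_subfield_pred hK) aE <-].
  (* The value [- 1/p^2] separates: elements of [K] stay strictly below it, while the first partial
     sum reaches it. *)
  apply: (@lt_le_trans _ _ (- pexp p 2)%:E%E).
    by rewrite ltNge; apply/negP => /val_geE; apply: dist1.
  apply/val_geE; apply: val_ge_trans (et_tail_val charp (N := 1)).
  by rewrite lerN2 -(pexpS charp 2) ler_pM2r ?(pexp_pos charp) // ler_nat ltnW.
move=> m [m1 [_ [b bm <-] bD]]; rewrite leEnat.
apply: (degree_ge_p bm).
apply: (alpha_in_ext charp kyK hensK perfK p_gt2).
  exact: deg_is_algebraic bm.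
(* [K] comes arbitrarily close to the value [- 1/p^2], so an element closer to [eta] than all of [K]
   reaches it. *)
apply: val_ge_dense => e /eta_approx_K[a aE ea].
apply/val_geE; apply: le_trans (ltW (bD (hval (et - a)) _)).
  exact/val_geE.
by exists a => //; apply: (deg_is1 hK); apply/(mem_subfield_pred hK).
Qed.

Lemma eta_depth_step2 : depth_step K et p (p ^ 2).
Proof.
have pp : (p < p ^ 2)%N by rewrite ltn_Pmulr // prime_gt1.
split.
  split=> //; exists +oo%E.
    by exists et; [exact: eta_degree | rewrite subrr hval0].
  move=> _ [b bp <-]; rewrite lt_neqAle leey andbT hval_eqy subr_eq0.
  apply: contraTneq pp => eb; rewrite -leqNgt.
  by rewrite -eb in bp; rewrite (deg_is_uniq eta_degree bp).
move=> m [pm [_ [b bm <-] bD]]; rewrite leEnat.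
have etb : val_ge (et - b) 0.
  apply: val_ge_dense => e e0; rewrite sub0r.
  have [N hN] := eta_approx charp e0.
  (* The index [N.+1] avoids the empty sum, whose degree is [1] and not [p]. *)
  apply/val_geE; apply: le_trans (ltW (bD (hval (et - et_trunc k p N.+1)) _)).
    by apply/val_geE; apply: hN.
  by exists (et_trunc k p N.+1) => //; apply: et_trunc_degree.
have [al_in et_in] := eta_in_ext charp kyK hensK perfK p_gt2
  (deg_is_algebraic hK bm) etb.
exact: (degree_ge_p2 bm).
Qed.

Lemma eta_depth : depth_is K et 2.
Proof.
exists (fun l => p ^ l)%N; split; first exact: expn0.
  case=> [|[|//]] _; rewrite ?expn0 expn1; first exact: eta_depth_step1.
  exact: eta_depth_step2.
exact: eta_degree.
Qed.

(** Depth [0] means degree [1], and depth [1] means degree [d 1], which is at most [p] by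
    [generator_L_closer]; but the degree is at least [p ^ 2]. *)
Lemma generator_depth_ge2 th r : th \in simple_ext L et ->
  (forall n, deg_is K th n -> al \in simple_ext E0 th /\ et \in simple_ext E0 th) ->
  depth_is K th r -> (2 <= r)%N.
Proof.
move=> thM gen [d [d0 dS dr]]; have [al_in et_in] := gen _ dr.
have d_ge := degree_ge_p2 dr al_in et_in.
have pp : (p < p ^ 2)%N by rewrite ltn_Pmulr // prime_gt1.
case: r dS dr d_ge => [|[|//]] dS dr d_ge.
  by move: d_ge; rewrite d0 leqNgt (ltn_trans (prime_gt1 p_pr)).
have thL : th \notin L.
  apply/negP => /L_degree[n thn np].
  by move: d_ge; rewrite (deg_is_uniq dr thn) leqNgt (leq_ltn_trans np pp).
have [b bL bD] := generator_L_closer hensK nflK p_gt2 thM thL.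
have [n bn np] := L_degree bL.
have [_ lb] := dS 0%N isT; rewrite d0 in lb.
suff : (d 1 <= n)%N.
  by move=> dn; move: d_ge; rewrite leqNgt (leq_ltn_trans (leq_trans dn np) pp).
rewrite -leEnat; apply: lb; split.
  (* If [b] had degree [1], it would lie in [K] and be strictly closer to [th] than itself. *)
  have := deg_is_gt0 bn; case: n bn np => [//|[|//]] b1 _ _.
  have /bD : b \in E0 by apply/(mem_subfield_pred hK)/(deg_is1_mem hK).
  by rewrite ltxx.
exists (hval (th - b)); first by exists b.
by move=> _ [a /(deg_is1_mem hK)/(mem_subfield_pred hK) aE <-]; apply: bD.
Qed.

End DegreeBounds.

(** * The minimum over all generators of [M] *)

Lemma polyOver_sub (U : nzRingType) (S S' : {pred U}) (f : {poly U}) :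
  {subset S <= S'} -> f \is a polyOver S -> f \is a polyOver S'.
Proof. by move=> SS /allP h; apply/allP => x /h; apply: SS. Qed.

Lemma mem_adjoin (U : fieldType) (K : set U) x y : K y \/ y = x -> adjoin K x y.
Proof. by move=> h; apply: sub_gen_smallest. Qed.

Theorem lemma4p11 (R : realType) (p : nat) (k : closedFieldType)
    (K : set (hahn k)) :
  p \in [pchar k] -> (2 < p)%N ->
  is_subfield K -> rat_subfield k `<=` K ->
  henselian K -> perfect p K -> no_finite_limits R K ->
  let L := adjoin K (alpha k p) in
  let M := adjoin L (eta k p) in
  ext_depth_is K M 2.
Proof.
move=> charp p_gt2 hK kyK hensK perfK nflK L M.
pose al := alpha k p; pose et := eta k p.
have charH := pchar_hahn charp.
pose E0 := subfield_pred hK : divringClosed (hahn k).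
have al_alg := alpha_algebraic charp hK kyK perfK.
have et_alg : et \in algebraic_over E0 := eta_algebraic charp hK kyK perfK.
pose Lp := ext_pred al_alg : divringClosed (hahn k).
have LP x : L x <-> x \in Lp := adjoinE al_alg x.
have hL : is_subfield L.
  have [h1 h2 h3] := GRing.divringClosedP Lp.
  split=> [|x y|x y]; rewrite !in_setE !LP; [exact: h1 | exact: h2 | exact: h3].
(* Two presentations of [L] are matched: as an intersection of subfields and as the polynomial
   values at [alpha]. *)
have subL x : x \in subfield_pred hL <-> x \in Lp.
  by rewrite -LP; apply: mem_subfield_pred.
have et_ASL : et ^+ p - et \in subfield_pred hL.
  by apply/subL; apply: (eta_AS_mem charp hK kyK perfK).
have MP x : M x <-> x \in simple_ext Lp et.
  apply: (iff_trans (adjoinE (as_algebraic charH et_ASL) x)).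
  split=> /simple_extP[f fL ->]; apply/simple_extP; exists f => //;
    by apply: polyOver_sub fL => y /subL.
have al_et : al \in simple_ext E0 et.
  apply: (alpha_in_ext charp kyK hensK perfK p_gt2 et_alg).
  by rewrite subrr; apply: val_ge0.
(* Since [alpha] lies in [K(eta)], the generator [eta] of [M] over [L] also generates [M] over
   [K]. *)
have ME : M = adjoin K et.
  apply/seteqP; split=> x.
    move=> /MP/simple_extP[f /polyOverP fL ->]; apply/(adjoinE et_alg).
    rewrite horner_coef.
    apply: (rpred_sum (S := ext_pred et_alg)) => i _.
    apply: (rpredM (s := ext_pred et_alg)); last first.
      by apply: (rpredX (S := ext_pred et_alg)); apply: gen_simple_ext.
    have /simple_extP[g /polyOverP gE ->] := fL i; rewrite horner_coef.
    apply: (rpred_sum (S := ext_pred et_alg)) => j _.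
    apply: (rpredM (s := ext_pred et_alg)); first exact: sub_simple_ext.
    by apply: (rpredX (S := ext_pred et_alg)).
  move=> /(adjoinE et_alg)/simple_extP[f fE ->]; apply/MP/simple_extP; exists f => //.
  by apply: polyOver_sub fE => y yE; apply: sub_simple_ext.
split.
  by exists et => //; apply: (eta_depth charp hK kyK hensK perfK nflK p_gt2).
move=> r [th Mth dr]; rewrite leEnat.
apply: (generator_depth_ge2 hensK nflK p_gt2 _ _ dr) => [|n thn].
  by apply/MP; rewrite Mth; apply: mem_adjoin; right.
have th_alg := deg_is_algebraic hK thn.
split; apply/(adjoinE th_alg); rewrite -Mth; apply: mem_adjoin; last by right.
by left; apply: mem_adjoin; right.
Qed.
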